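(* There is a unique basis $B^*=\{b(A)\mid A\in M_n(\mathbb{Z}_+)\}$ of the $\mathbb{Z}[q]$-module $L^*=\bigoplus_{A\in M_n(\mathbb{Z}_+)}\mathbb{Z}[q]Z(A)\subset O_q(M(n))$ determined by the following conditions: (1) $\overline{b(A)}=b(A)$ for all $A$; (2) $b(A)=Z(A)+\sum_{B<A}h_B(A)Z(B)$, where $h_B(A)\in q\mathbb{Z}[q]$ and the sum runs over matrices $B\in M_n(\mathbb{Z}_+)$ with $B<A$, $ro(B)=ro(A)$, $co(B)=co(A)$.
   Context: Let $K=\mathbb{Q}(q)$ and $\mathbb{Z}_+=\{0,1,2,\dots\}$. $O_q(M(n))$ is the associative $K$-algebra generated by $Z_{ij}$ ($1\le i,j\le n$) with relations $Z_{ij}Z_{ik}=q^2Z_{ik}Z_{ij}$ if $j<k$; $Z_{ij}Z_{kj}=q^2Z_{kj}Z_{ij}$ if $i<k$; $Z_{ij}Z_{st}=Z_{st}Z_{ij}$ if $i>s,\ j<t$; $Z_{ij}Z_{st}=Z_{st}Z_{ij}+(q^2-q^{-2})Z_{it}Z_{sj}$ if $i<s,\ j<t$. The bar map $\overline{\phantom{x}}$ is the anti-automorphism of $O_q(M(n))$ as a $\mathbb{Q}$-algebra with $Z_{ij}\mapsto Z_{ij}$, $q\mapsto q^{-1}$. For $A=(a_{ij})\in M_n(\mathbb{Z}_+)$ let $Z^A=\prod_{i,j}Z_{ij}^{a_{ij}}$ with factors arranged in lexicographic order of $(i,j)$; let $D(A)=q^{-\sum_i\sum_{j>k}a_{ij}a_{ik}-\sum_i\sum_{j>k}a_{ji}a_{ki}}$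 and $Z(A)=D(A)Z^A$. The elements $Z^A$ form a $K$-basis of $O_q(M(n))$. $ro(A)=(\sum_ja_{1j},\dots,\sum_ja_{nj})$ and $co(A)=(\sum_ja_{j1},\dots,\sum_ja_{jn})$ are the vectors of row sums and column sums. The order $\le$ on $M_n(\mathbb{Z}_+)$ is lexicographic: $B<A$ if, reading entries in lexicographic order of positions $(i,j)$, the first entry where they differ is smaller in $B$. *)

(* Defs.v *)
From HB Require Import structures.
From mathcomp Require Import all_boot all_order all_algebra.
From mathcomp Require Import generic_quotient ring_quotient fraction.
From mathcomp Require Import finmap monalg.
From mathcomp Require Import boolp classical_sets cardinality fsbigop.

Set Implicit Arguments.
Unset Strict Implicit.
Unset Printing Implicit Defensive.

Import GRing.Theory.
Local Open Scope ring_scope.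
Local Open Scope quotient_scope.

Notation Qq := {fraction {poly rat}}.

Local Notation "x %:F" := (@FracField.tofrac _ x).

Definition q : Qq := ('X : {poly rat})%:F.

Lemma q_neq0 : q != 0.
Proof. by rewrite tofrac_eq0 polyX_eq0. Qed.

(* barQq, defined below, is the field automorphism of Q(q) sending q to q^-1:
   numerator and denominator are evaluated at q^-1. *)

Definition ratQq (c : rat) : Qq := (c%:P)%:F.

HB.instance Definition _ := GRing.RMorphism.copy ratQq
  (@FracField.tofrac {poly rat} \o polyC).

Definition eval_qV (p : {poly rat}) : Qq := (map_poly ratQq p).[q^-1].

HB.instance Definition _ := GRing.RMorphism.copy eval_qV
  (horner_eval q^-1 \o map_poly ratQq).

Lemma eval_qV_eq0 p : (eval_qV p == 0) = (p == 0).
Proof.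
apply/eqP/eqP => [|->]; last exact: rmorph0.
rewrite /eval_qV (@horner_coef_wide _ (size p)) ?size_poly // => p0.
pose r : {poly rat} := \poly_(i < size p) p`_((size p).-1 - i).
suff r0 : r = 0.
  apply/polyP => i; rewrite coef0; case: (ltnP i (size p)) => [ip|?]; last first.
    by rewrite nth_default.
  have /(congr1 (fun s : {poly rat} => s`_((size p).-1 - i))) := r0.
  rewrite coef_poly coef0; case: (size p) ip => // m im /=.
  by rewrite ltnS leq_subr subKn.
apply/eqP; rewrite -tofrac_eq0.
have -> : r%:F = q ^+ (size p).-1 *
    (\sum_(i < size p) (map_poly ratQq p)`_i * q^-1 ^+ i).
  rewrite mulr_sumr /r poly_def raddf_sum (reindex_inj rev_ord_inj) /=.
  apply: eq_bigr => i _; rewrite coef_map mulrCA.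
  case: (size p) i => [[]//|m] i /=.
  have im : (i <= m)%N by rewrite -ltnS.
  rewrite subSS subKn // -mul_polyC rmorphM /= rmorphXn /=.
  rewrite exprVn -expfB_cond ?(negPf q_neq0) //.
by rewrite p0 mulr0.
Qed.

Lemma repr_frac (x : Qq) :
  x = (\n_(repr x))%:F / (\d_(repr x))%:F /\ \d_(repr x) != 0.
Proof.
split; last exact: denom_ratioP.
rewrite -{1}[x]reprK; move: (repr x) => {x} y.
apply/(canRL (mulfK _)); rewrite ?tofrac_eq0 ?denom_ratioP //.
unlock FracField.tofrac; rewrite !piE.
apply/eqP; rewrite piE /FracField.equivf /FracField.mulf /=.
by rewrite !numden_Ratio ?mulf_neq0 ?denom_ratioP ?oner_eq0 // !mulr1 mulrC.
Qed.

Definition barQq (x : Qq) : Qq := eval_qV \n_(repr x) / eval_qV \d_(repr x).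

Lemma barQqE (x : Qq) a b : b != 0 -> x = a%:F / b%:F ->
  barQq x = eval_qV a / eval_qV b.
Proof.
move=> b0 xE; have [xr d0] := repr_frac x.
rewrite /barQq; apply/eqP; rewrite eqr_div ?eval_qV_eq0 //.
rewrite -!rmorphM /=; apply/eqP; congr eval_qV.
by apply/eqP; rewrite -tofrac_eq !rmorphM /= -eqr_div ?tofrac_eq0 // -xr -xE.
Qed.

Lemma Qq_fracP (x : Qq) : exists a b : {poly rat}, b != 0 /\ x = a%:F / b%:F.
Proof.
by exists \n_(repr x), \d_(repr x); have [] := repr_frac x.
Qed.

Lemma barQq_is_zmod_morphism : zmod_morphism barQq.
Proof.
move=> x y; have [a [b [b0 xE]]] := Qq_fracP x; have [c [d [d0 yE]]] := Qq_fracP y.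
rewrite (barQqE b0 xE) (barQqE d0 yE).
rewrite (@barQqE _ (a * d - c * b) (b * d)) ?mulf_neq0 //.
  by rewrite rmorphB !rmorphM -[in RHS]mulNr addf_div ?eval_qV_eq0 // mulNr.
by rewrite xE yE rmorphB !rmorphM -[in LHS]mulNr addf_div ?tofrac_eq0 // mulNr.
Qed.

Lemma barQq_is_monoid_morphism : monoid_morphism barQq.
Proof.
split=> [|x y].
  by rewrite (@barQqE _ 1 1) ?oner_eq0 // !rmorph1 divr1.
have [a [b [b0 xE]]] := Qq_fracP x; have [c [d [d0 yE]]] := Qq_fracP y.
rewrite (barQqE b0 xE) (barQqE d0 yE).
rewrite (@barQqE _ (a * c) (b * d)) ?mulf_neq0 //.
  by rewrite !rmorphM mulf_div.
by rewrite xE yE !rmorphM mulf_div.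
Qed.

HB.instance Definition _ :=
  GRing.isZmodMorphism.Build Qq Qq barQq barQq_is_zmod_morphism.
HB.instance Definition _ :=
  GRing.isMonoidMorphism.Build Qq Qq barQq barQq_is_monoid_morphism.

Lemma barQq_q : barQq q = q^-1.
Proof.
rewrite (@barQqE _ 'X 1) ?oner_eq0 // ?rmorph1 ?divr1 //.
by rewrite /eval_qV map_polyX hornerX.
Qed.

(* Quotient of an algebra by the two-sided ideal generated by [rel]. *)

Section TwoSidedQuotient.
Variables (F : comNzRingType) (A : algType F) (rel : A -> Prop).

Inductive tsideal : A -> Prop :=
| TsIdeal0 : tsideal 0
| TsIdealD u r v x of rel r & tsideal x : tsideal (u * r * v + x).

Lemma tsidealD x y : tsideal x -> tsideal y -> tsideal (x + y).
Proof.
move=> + yI; elim=> [|u r v {}x rr _ IH]; first by rewrite add0r.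
by rewrite -addrA; apply: TsIdealD.
Qed.

Lemma tsidealM u v x : tsideal x -> tsideal (u * x * v).
Proof.
elim=> [|u' r v' {}x rr _ IH]; first by rewrite mulr0 mul0r; apply: TsIdeal0.
rewrite mulrDr mulrDl.
have -> : u * (u' * r * v') * v = (u * u') * r * (v' * v) by rewrite !mulrA.
exact: TsIdealD.
Qed.

Lemma tsideal_rel r : rel r -> tsideal r.
Proof.
move=> rr; have := TsIdealD 1 1 rr TsIdeal0.
by rewrite mul1r mulr1 addr0.
Qed.

Definition tsidealb : {pred A} := fun x => `[< tsideal x >].

Lemma tsidealbP x : reflect (tsideal x) (x \in tsidealb).
Proof. exact: asboolP. Qed.

Lemma tsideal_zmod_closed : zmod_closed tsidealb.
Proof.
split=> [|x y /tsidealbP xI /tsidealbP yI]; apply/tsidealbP.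
  exact: TsIdeal0.
apply: tsidealD => //.
by have := tsidealM (-1) 1 yI; rewrite mulN1r mulr1.
Qed.

HB.instance Definition _ :=
  GRing.isZmodClosed.Build A tsidealb tsideal_zmod_closed.

Hypothesis rel_proper : ~ tsideal 1.

Definition tsquot of ~ tsideal 1 : Type := Quotient.quot tsidealb.
Local Notation Q := (tsquot rel_proper).

HB.instance Definition _ := GRing.Zmodule.on Q.

Definition tspi (x : A) : Q := \pi_(Quotient.quot tsidealb) x.
Definition tsrepr (x : Q) : A := repr (x : Quotient.quot tsidealb).

Lemma tsreprK : cancel tsrepr tspi.
Proof. exact: reprK. Qed.

Lemma tspi_eq x y : tspi x = tspi y <-> tsideal (x - y).
Proof.
split=> [/eqP|/tsidealbP xyI]; first by rewrite -Quotient.idealrBE => /tsidealbP.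
by apply/eqP; rewrite -Quotient.idealrBE.
Qed.

Lemma tspi_is_zmod_morphism : zmod_morphism tspi.
Proof. exact: raddfB. Qed.
HB.instance Definition _ :=
  GRing.isZmodMorphism.Build A Q tspi tspi_is_zmod_morphism.

Definition tsquot_mul (x y : Q) : Q := tspi (tsrepr x * tsrepr y).
Definition tsquot_scale (c : F) (x : Q) : Q := tspi (c *: tsrepr x).

Lemma tsideal_repr x : tsideal (tsrepr (tspi x) - x).
Proof. by apply/tspi_eq; rewrite tsreprK. Qed.

Lemma tspiM x y : tspi (x * y) = tsquot_mul (tspi x) (tspi y).
Proof.
apply/esym/tspi_eq; set x' := tsrepr _; set y' := tsrepr _.
have -> : x' * y' - x * y = (1 * (x' - x) * y') + (x * (y' - y) * 1).
  by rewrite mul1r mulr1 mulrBl mulrBr addrA subrK.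
by apply: tsidealD; apply: tsidealM; apply: tsideal_repr.
Qed.

Lemma tspiZ c x : tspi (c *: x) = tsquot_scale c (tspi x).
Proof.
apply/esym/tspi_eq; rewrite -scalerBr -mulr_algl -[_ * _]mulr1.
by apply: tsidealM; apply: tsideal_repr.
Qed.

Lemma tsquot_mulA : associative tsquot_mul.
Proof.
by move=> x y z; rewrite -[x]tsreprK -[y]tsreprK -[z]tsreprK -!tspiM mulrA.
Qed.
Lemma tsquot_mul1 : left_id (tspi 1) tsquot_mul.
Proof. by move=> x; rewrite -[x]tsreprK -tspiM mul1r. Qed.
Lemma tsquot_mulr1 : right_id (tspi 1) tsquot_mul.
Proof. by move=> x; rewrite -[x]tsreprK -tspiM mulr1. Qed.
Lemma tsquot_mulDl : left_distributive tsquot_mul +%R.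
Proof.
move=> x y z; rewrite -[x]tsreprK -[y]tsreprK -[z]tsreprK.
by rewrite -raddfD -!tspiM -raddfD mulrDl.
Qed.
Lemma tsquot_mulDr : right_distributive tsquot_mul +%R.
Proof.
move=> x y z; rewrite -[x]tsreprK -[y]tsreprK -[z]tsreprK.
by rewrite -raddfD -!tspiM -raddfD mulrDr.
Qed.
Lemma tsquot_1_neq0 : tspi 1 != 0.
Proof.
by apply/eqP; rewrite -(raddf0 tspi) => /tspi_eq; rewrite subr0.
Qed.

HB.instance Definition _ := GRing.Zmodule_isNzRing.Build Q
  tsquot_mulA tsquot_mul1 tsquot_mulr1 tsquot_mulDl tsquot_mulDr tsquot_1_neq0.

Lemma tsquot_scaleA a b x :
  tsquot_scale a (tsquot_scale b x) = tsquot_scale (a * b) x.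
Proof. by rewrite -[x]tsreprK -!tspiZ scalerA. Qed.
Lemma tsquot_scale1 : left_id 1 tsquot_scale.
Proof. by move=> x; rewrite -[x]tsreprK -tspiZ scale1r. Qed.
Lemma tsquot_scaleDr : right_distributive tsquot_scale +%R.
Proof.
move=> c x y; rewrite -[x]tsreprK -[y]tsreprK.
by rewrite -raddfD -!tspiZ -raddfD scalerDr.
Qed.
Lemma tsquot_scaleDl x : {morph tsquot_scale^~ x : a b / a + b}.
Proof.
by move=> a b; rewrite -[x]tsreprK -!tspiZ -raddfD scalerDl.
Qed.

HB.instance Definition _ := GRing.Zmodule_isLmodule.Build F Q
  tsquot_scaleA tsquot_scale1 tsquot_scaleDr tsquot_scaleDl.

Lemma tspi_is_monoid_morphism : monoid_morphism tspi.
Proof. by split=> // x y; apply: tspiM. Qed.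
HB.instance Definition _ :=
  GRing.isMonoidMorphism.Build A Q tspi tspi_is_monoid_morphism.
HB.instance Definition _ :=
  GRing.isScalable.Build F A Q *:%R tspi tspiZ.

Lemma tsquot_scaleAl c (x y : Q) : c *: (x * y) = c *: x * y.
Proof.
by rewrite -[x]tsreprK -[y]tsreprK -rmorphM -!linearZ -rmorphM scalerAl.
Qed.
HB.instance Definition _ := GRing.Lmodule_isLalgebra.Build F Q tsquot_scaleAl.

Lemma tsquot_scaleAr c (x y : Q) : c *: (x * y) = x * (c *: y).
Proof.
by rewrite -[x]tsreprK -[y]tsreprK -rmorphM -!linearZ -rmorphM scalerAr.
Qed.
HB.instance Definition _ := GRing.Lalgebra_isAlgebra.Build F Q tsquot_scaleAr.

End TwoSidedQuotient.

Section FreeAlgebra.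
Variables (R : comNzRingType) (I : choiceType).

Definition falg : Type := {malg R[{fmonom I}]}.
HB.instance Definition _ := GRing.Lalgebra.on falg.

Lemma falg_mulC (c : R) (x : falg) : x * malgC c = malgC c * x.
Proof.
rewrite [LHS](fgmulgU c mone x) [RHS](fgmulUg c mone x).
by apply: eq_bigr => w _; rewrite mulrC mulm1 mul1m.
Qed.

Lemma falg_scaleAr c (x y : falg) : c *: (x * y) = x * (c *: y).
Proof.
have E w : c *: w = malgC c * w by apply/esym/mul_malgC.
by rewrite !E mulrA -falg_mulC mulrA.
Qed.
HB.instance Definition _ := GRing.Lalgebra_isAlgebra.Build R falg falg_scaleAr.

Definition fgen (i : I) : falg := << fmu i >>.

Definition fconst (x : falg) : R := mcoeff mone x.

Lemma fconst_is_zmod_morphism : zmod_morphism fconst.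
Proof. by move=> x y; apply: mcoeffB. Qed.
HB.instance Definition _ :=
  GRing.isZmodMorphism.Build falg R fconst fconst_is_zmod_morphism.

Lemma fconst_is_monoid_morphism : monoid_morphism fconst.
Proof. by have [M one] := @mcoeff1g_is_multiplicative {fmonom I} R. Qed.
HB.instance Definition _ :=
  GRing.isMonoidMorphism.Build falg R fconst fconst_is_monoid_morphism.

Lemma fconstZ c x : fconst (c *: x) = c * fconst x.
Proof. exact: mcoeffZ. Qed.

Lemma fconst_gen i : fconst (fgen i) = 0.
Proof.
rewrite /fconst mcoeffU; case: eqP => // /(congr1 (@fdeg _)).
by rewrite fdegU fdeg1.
Qed.

(* The anti-endomorphism reversing words and applying [sigma] to scalars. *)
Variable sigma : {rmorphism R -> R}.

Definition fword_rev (w : {fmonom I}) : {fmonom I} :=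
  FMonom (rev (fmonom_val w)).

Lemma fmonom_inj (u v : {fmonom I}) : u = v :> seq I -> u = v.
Proof. by case: u v => u [v] /= ->. Qed.

Lemma fword_revM u v : fword_rev (mmul u v) = mmul (fword_rev v) (fword_rev u).
Proof. by apply: fmonom_inj; rewrite [RHS]fmM /= fmM rev_cat. Qed.

Definition frev (x : falg) : falg :=
  \sum_(w <- msupp x) << sigma (mcoeff w x) *g fword_rev w >>.

Lemma frevEw (d : {fset {fmonom I}}) (x : falg) : fsubset (msupp x) d ->
  frev x = \sum_(w <- d) << sigma (mcoeff w x) *g fword_rev w >>.
Proof.
move=> le; rewrite [LHS](big_fset_incl _ le) //= => w _ /mcoeff_outdom ->.
by rewrite rmorph0 monalgU0.
Qed.

Lemma frevU (c : R) w : frev << c *g w >> = << sigma c *g fword_rev w >>.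
Proof. by rewrite (frevEw msuppU_le) big_seq_fset1 mcoeffUU. Qed.

Lemma frev_is_zmod_morphism : zmod_morphism frev.
Proof.
move=> x y; pose d := fsetU (msupp x) (msupp y).
have xd : fsubset (msupp x) d by apply: fsubsetUl.
have yd : fsubset (msupp y) d by apply: fsubsetUr.
rewrite (frevEw xd) (frevEw yd) (@frevEw d); last exact: msuppB_le.
rewrite -sumrB; apply: eq_bigr => w _.
by rewrite mcoeffB rmorphB monalgUB.
Qed.
HB.instance Definition _ :=
  GRing.isZmodMorphism.Build falg falg frev frev_is_zmod_morphism.

Lemma falg_mulUU (c d : R) (u v : {fmonom I}) :
  (<< c *g u >> : falg) * (<< d *g v >> : falg) = << c * d *g mmul u v >>.
Proof. exact: fgmulUU. Qed.

Lemma frevM x y : frev (x * y) = frev y * frev x.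
Proof.
have fE t : frev t =
  \sum_(w <- msupp t) << sigma (mcoeff w t) *g fword_rev w >> by [].
rewrite [x * y]malgME raddf_sum (fE x) mulr_sumr; apply: eq_bigr => u _.
rewrite raddf_sum (fE y) mulr_suml; apply: eq_bigr => v _.
by rewrite /= frevU falg_mulUU fword_revM rmorphM mulrC.
Qed.

Lemma frev1 : frev 1 = 1.
Proof.
by rewrite [LHS]frevU rmorph1; congr mkmalgU; apply: fmonom_inj; rewrite /= fm1.
Qed.

Lemma frevZ (c : R) x : frev (c *: x) = sigma c *: frev x.
Proof.
rewrite (frevEw (msuppZ_le c x)) /frev scaler_sumr; apply: eq_bigr => w _.
rewrite mcoeffZ rmorphM; apply/malgP => v.
by rewrite mcoeffZ !mcoeffU mulrnAr.
Qed.

Lemma frev_gen i : frev (fgen i) = fgen i.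
Proof.
rewrite /fgen frevU rmorph1; congr mkmalgU.
by apply: fmonom_inj; rewrite fmU /= fmU.
Qed.

End FreeAlgebra.

Section QuantumRelations.
Variables (K : fieldType) (q : K) (n : nat) (A : algType K).
Variable z : 'I_n -> 'I_n -> A.

(* Each relation u = v is encoded by the relator u - v. *)
Inductive Oq_rel : A -> Prop :=
| OqRelRow (i j k : 'I_n) of (j < k)%N :
    Oq_rel (z i j * z i k - q ^+ 2 *: (z i k * z i j))
| OqRelCol (i j k : 'I_n) of (i < k)%N :
    Oq_rel (z i j * z k j - q ^+ 2 *: (z k j * z i j))
| OqRelComm (i j s t : 'I_n) of (s < i)%N & (j < t)%N :
    Oq_rel (z i j * z s t - z s t * z i j)
| OqRelDiag (i j s t : 'I_n) of (i < s)%N & (j < t)%N :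
    Oq_rel (z i j * z s t -
            (z s t * z i j + (q ^+ 2 - q ^- 2) *: (z i t * z s j))).

Lemma Oq_rel_proper (e : {rmorphism A -> K}) :
  (forall c x, e (c *: x) = c * e x) -> (forall i j, e (z i j) = 0) ->
  ~ tsideal Oq_rel 1.
Proof.
move=> eZ e0; suff I0 x : tsideal Oq_rel x -> e x = 0.
  by move=> /I0 /eqP; rewrite rmorph1 oner_eq0.
elim=> [|u r v {}x rr _ IH]; first exact: rmorph0.
rewrite rmorphD !rmorphM /= IH addr0.
suff -> : e r = 0 by rewrite mulr0 mul0r.
by case: rr => *; rewrite rmorphB ?rmorphD /= ?eZ !rmorphM !e0 ?mulr0 ?addr0 subr0.
Qed.

Variables (sigma : {rmorphism K -> K}) (f : {additive A -> A}).
Hypotheses (q_neq0 : q != 0) (sigma_q : sigma q = q^-1).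
Hypotheses (fM : forall x y, f (x * y) = f y * f x)
           (fZ : forall c x, f (c *: x) = sigma c *: f x)
           (fz : forall i j, f (z i j) = z i j).

Lemma Oq_rel_rev r : Oq_rel r -> tsideal Oq_rel (f r).
Proof.
have bq2 : sigma (q ^+ 2) = q ^- 2 by rewrite rmorphXn /= sigma_q exprVn.
have bqV2 : sigma (q ^- 2) = q ^+ 2 by rewrite fmorphV bq2 invrK.
have q2 : q ^- 2 * q ^+ 2 = 1 by rewrite mulVf ?expf_neq0.
have scal c x : tsideal Oq_rel x -> tsideal Oq_rel (c *: x).
  by rewrite -mulr_algl -[_ * x]mulr1; apply: tsidealM.
case=> [i j k jk|i j k ik|i j s t si jt|i j s t si jt].
- have /tsideal_rel/(scal (- q ^- 2)) := OqRelRow i jk.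
  rewrite (raddfB f) /= fZ !fM !fz bq2 scalerBr scalerA mulNr q2 scaleN1r.
  by rewrite opprK addrC scaleNr.
- have /tsideal_rel/(scal (- q ^- 2)) := OqRelCol j ik.
  rewrite (raddfB f) /= fZ !fM !fz bq2 scalerBr scalerA mulNr q2 scaleN1r.
  by rewrite opprK addrC scaleNr.
- have /tsideal_rel/(scal (-1)) := OqRelComm si jt.
  by rewrite (raddfB f) /= !fM !fz scaleN1r opprB.
have /tsideal_rel/(scal (-1)) I1 := OqRelDiag si jt.
have /tsideal_rel/(scal (q ^+ 2 - q ^- 2)) I2 := OqRelComm si jt.
have := tsidealD I1 I2; rewrite (raddfB f) (raddfD f) /= fZ !fM !fz.
rewrite rmorphB /= bq2 bqV2 scaleN1r opprB scalerBr -[q ^- 2 - _]opprB scaleNr.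
set a := _ *: _; set b := _ *: _; set c := z i j * _; set d := _ * z i j.
by rewrite [b - a]addrC addrA [d + a - c]addrAC addrK opprB [b - c]addrC addrA.
Qed.

Lemma tsideal_rev x : tsideal Oq_rel x -> tsideal Oq_rel (f x).
Proof.
elim=> [|u r v {}x rr _ IH]; first by rewrite (raddf0 f); apply: TsIdeal0.
rewrite (raddfD f) /= !fM mulrA; apply: tsidealD => //.
exact/tsidealM/Oq_rel_rev.
Qed.

End QuantumRelations.

Section QuantumMatrices.
Variables (K : fieldType) (q : K) (n : nat).

Definition freeZ : algType K := falg K ('I_n * 'I_n)%type.
Definition freeZgen (i j : 'I_n) : freeZ := fgen K (i, j).

Lemma freeZ_proper : ~ tsideal (Oq_rel q freeZgen) 1.
Proof.
apply: (@Oq_rel_proper _ _ _ _ _ (@fconst K ('I_n * 'I_n)%type)) => *.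
  exact: fconstZ.
exact: fconst_gen.
Qed.

(* Oq q n is the algebra presented by the generators Zgen i j and the
   relations Oq_rel. *)
Definition Oq : algType K := tsquot freeZ_proper.

Definition Zgen (i j : 'I_n) : Oq := tspi freeZ_proper (freeZgen i j).

Section Bar.
Variable sigma : {rmorphism K -> K}.

(* By bar_pi, bar is induced by word reversal on the free algebra. When
   sigma q = q^-1 it is the additive anti-multiplicative map with
   bar (c *: x) = sigma c *: bar x that fixes the generators. *)
Definition bar (x : Oq) : Oq := tspi freeZ_proper (frev sigma (tsrepr x)).

Hypotheses (q_neq0 : q != 0) (sigma_q : sigma q = q^-1).

Lemma bar_pi x : bar (tspi freeZ_proper x) = tspi freeZ_proper (frev sigma x).
Proof.
apply/tspi_eq; rewrite -(raddfB (frev sigma)).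
apply: (tsideal_rev (f := frev sigma) q_neq0 sigma_q).
- exact: frevM.
- exact: frevZ.
- by move=> i j; apply: frev_gen.
exact: tsideal_repr.
Qed.

Lemma bar_is_zmod_morphism : zmod_morphism bar.
Proof.
move=> x y; rewrite -[x]tsreprK -[y]tsreprK -raddfB !bar_pi.
by rewrite (raddfB (frev sigma)) raddfB.
Qed.

Lemma barM x y : bar (x * y) = bar y * bar x.
Proof. by rewrite -[x]tsreprK -[y]tsreprK -rmorphM !bar_pi frevM rmorphM. Qed.

Lemma bar1 : bar 1 = 1.
Proof. by rewrite -(rmorph1 (tspi freeZ_proper)) bar_pi frev1. Qed.

Lemma barZ c x : bar (c *: x) = sigma c *: bar x.
Proof. by rewrite -[x]tsreprK -linearZ !bar_pi frevZ linearZ. Qed.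

Lemma bar_gen i j : bar (Zgen i j) = Zgen i j.
Proof. by rewrite bar_pi; congr (tspi _ _); apply: frev_gen. Qed.

End Bar.
End QuantumMatrices.

Section CanonicalBasis.
Variables (K : fieldType) (q : K) (n : nat).
Implicit Types A B : 'M[nat]_n.

Definition ro A : 'rV[nat]_n := \row_i (\sum_j A i j)%N.
Definition co A : 'rV[nat]_n := \row_i (\sum_j A j i)%N.

Definition pos_lt (i j k l : 'I_n) := (i < k)%N || ((i == k) && (j < l)%N).

Definition mx_lt B A :=
  [exists i, exists j, (B i j < A i j)%N &&
    [forall k, forall l, pos_lt k l i j ==> (B k l == A k l)]].

(* Finite by finite_below, so that \sum_(B \in below A) is a genuine sum. *)
Definition below A : set 'M[nat]_n :=
  [set B | [&& mx_lt B A, ro B == ro A & co B == co A]].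

Lemma finite_below A : finite_set (below A).
Proof.
pose m := (\sum_i \sum_j A i j)%N.
pose g (M : 'M['I_m.+1]_n) : 'M[nat]_n := map_mx val M.
apply: (sub_finite_set (B := (g @` setT)%classic)); last exact: finite_image.
move=> B /and3P[_ /eqP roE _]; exists (map_mx inord B) => //.
apply/matrixP => i j; rewrite !mxE /= inordK // ltnS.
have /(congr1 (fun u : 'rV_n => u 0 i)) := roE; rewrite !mxE => ri.
apply: (@leq_trans (\sum_j B i j)%N); first by rewrite (bigD1 j) //= leq_addr.
by rewrite ri /m [leqRHS](bigD1 i) //= leq_addr.
Qed.

(* The nested products run through the positions in lexicographic order. *)
Definition Zmon A : Oq q n := \prod_(i < n) \prod_(j < n) Zgen q i j ^+ A i j.

Definition Dexp A : nat :=
  (\sum_(i < n) \sum_(j < n) \sum_(k < n | k < j) A i j * A i k +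
   \sum_(i < n) \sum_(j < n) \sum_(k < n | k < j) A j i * A k i)%N.

Definition Znorm A : Oq q n := q ^- Dexp A *: Zmon A.

(* Z[q] is {poly int}, acting on K-modules through evaluation at q. *)
Definition Zq_val (p : {poly int}) : K := (map_poly intr p).[q].

(* Families in {malg {poly int}[_]} are the finitely supported ones. *)
Definition Zq_comb (v : 'M[nat]_n -> Oq q n)
    (c : {malg {poly int}['M[nat]_n]}) : Oq q n :=
  \sum_(A <- msupp c) Zq_val (mcoeff A c) *: v A.

(* Linear independence of the Znorm A is not part of this definition. *)
Definition Lstar : set (Oq q n) := [set x | exists c, x = Zq_comb Znorm c].

Definition is_Zq_basis (L : set (Oq q n)) (v : 'M[nat]_n -> Oq q n) : Prop :=
  (forall A, L (v A)) /\ (forall x, L x -> exists! c, x = Zq_comb v c).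

End CanonicalBasis.

Arguments Zmon {K} q {n} A.
Arguments Znorm {K} q {n} A.
Arguments Lstar {K} q n.

(* Main.v *)
(** Linear independence of the monomials [Z^A] comes from a representation.
    In R-matrix (RTT) form the relations are stable under products of matrices
    whose entries commute, and a bidiagonal matrix of q-commuting shift and
    twist operators satisfies them.  A product of such 2n x 2n matrices is a
    sum over lattice paths, and its upper right n x n block represents
    [Z_ij]; the lightest path is unique, so [Z^A] has a leading monomial from
    which [A] can be read off.

    Modulo the Z[q, q^-1]-span of the [Z(B)] with [B] below [A], the letters of
    a word of content [A] commute up to powers of [q^2], since the correction
    term of the fourth relation is lexicographically smaller.  Reversing the
    word of [Z^A] produces [q^(-2 D)] with [q^(-D) = D(A)], so that
    [bar Z(A) = Z(A) + lower terms].

    The Kazhdan-Lusztig argument then applies: once the canonical elements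
    below [A] are known, [bar Z(A) - Z(A)] has coefficients [s] in them with
    [bar s = - s], hence [s = h - bar h] for a unique [h] in [q Z[q]]. *)

Require Import Defs.
From HB Require Import structures.
From mathcomp Require Import all_boot all_order all_algebra.
From mathcomp Require Import zify ring.
From mathcomp Require Import finmap monalg.
From mathcomp Require Import boolp classical_sets functions cardinality fsbigop.
Import GRing.Theory.

Set Implicit Arguments.
Unset Strict Implicit.
Unset Printing Implicit Defensive.

Local Open Scope ring_scope.

(** * Linear extensions and actions of the free algebra *)

Section MalgLift.
Variables (R : comNzRingType) (M : choiceType) (V : lmodType R).
Implicit Types (v : M -> V) (c : {malg R[M]}).

Definition malg_lift v c : V := \sum_(k <- msupp c) mcoeff k c *: v k.

Lemma malg_liftEw v c (d : {fset M}) : fsubset (msupp c) d ->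
  malg_lift v c = \sum_(k <- d) mcoeff k c *: v k.
Proof.
move=> le; rewrite /malg_lift (big_fset_incl _ le) //= => k _ /mcoeff_outdom ->.
by rewrite scale0r.
Qed.

Lemma malg_lift_is_linear v : linear (malg_lift v).
Proof.
move=> a c c'; pose d := fsetU (msupp c) (msupp c').
rewrite (@malg_liftEw v c d) ?fsubsetUl // (@malg_liftEw v c' d) ?fsubsetUr //.
rewrite (@malg_liftEw v _ d); last first.
  apply: (fsubset_trans (msuppD_le _ _)); apply: fsetSU; exact: msuppZ_le.
rewrite scaler_sumr -big_split; apply: eq_bigr => k _ /=.
by rewrite mcoeffD mcoeffZ scalerDl scalerA.
Qed.
HB.instance Definition _ v :=
  GRing.isLinear.Build R {malg R[M]} V *:%R (malg_lift v) (malg_lift_is_linear v).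

Lemma malg_liftU v a k : malg_lift v << a *g k >> = a *: v k.
Proof. by rewrite (@malg_liftEw _ _ [fset k]%fset) ?msuppU_le // big_seq_fset1 mcoeffUU. Qed.

Lemma mcoeff_sumU (F : {fset M}) (f : M -> R) k :
  mcoeff k (\sum_(j <- F) << f j *g j >> : {malg R[M]}) =
  if k \in F then f k else 0.
Proof.
rewrite raddf_sum; case: ifP => kF.
  rewrite (big_fsetD1 k) //= mcoeffUU big_seq big1 ?addr0 // => j.
  by case/fsetD1P => jk _; rewrite mcoeffU (negPf jk).
rewrite big_seq big1 // => j jF; rewrite /= mcoeffU.
by case: eqP => // jk; rewrite jk kF in jF.
Qed.

End MalgLift.

Section FreeAlgebraAction.
Variables (R : comNzRingType) (I : choiceType) (V : lmodType R).
Variable T : I -> {linear V -> V}.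

Definition word_act (w : seq I) (f : V) : V := foldr (fun i => T i) f w.

Lemma word_act_is_linear w : linear (word_act w).
Proof. by elim: w => [|i w IH] a f g //=; rewrite IH linearP. Qed.
HB.instance Definition _ w :=
  GRing.isLinear.Build R V V *:%R (word_act w) (word_act_is_linear w).

Definition falg_act (f : V) (x : falg R I) : V :=
  malg_lift (fun w : {fmonom I} => word_act w f) x.

Lemma falg_act_is_linear f : linear (falg_act f).
Proof. by move=> a x y; rewrite /falg_act linearP. Qed.
HB.instance Definition _ f := GRing.isLinear.Build R (falg R I) V *:%R
  (falg_act f) (falg_act_is_linear f).

Lemma falg_act0 x : falg_act 0 x = 0.
Proof. by apply: big1 => w _; rewrite linear0 scaler0. Qed.

Lemma falg_actM f x y : falg_act f (x * y) = falg_act (falg_act f y) x.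
Proof.
have fE t g : falg_act g t =
  \sum_(w <- msupp t) mcoeff w t *: word_act w g by [].
rewrite [x * y]malgME raddf_sum (fE x); apply: eq_bigr => u _ /=.
rewrite raddf_sum (fE y) raddf_sum scaler_sumr; apply: eq_bigr => w _ /=.
by rewrite [LHS]malg_liftU linearZ /= fmM /word_act foldr_cat scalerA.
Qed.

Lemma falg_act_gen f i : falg_act f (fgen R i) = T i f.
Proof. by rewrite [LHS]malg_liftU scale1r fmU. Qed.

Lemma falg_act1 f : falg_act f 1 = f.
Proof. by rewrite [LHS]malg_liftU scale1r fm1. Qed.

End FreeAlgebraAction.

(** * The RTT form of the relations *)

Section RTT.
Variables (K : fieldType) (p : K) (V : lmodType K).
Hypothesis p_neq0 : p != 0.

(** Off-diagonal data of the R-matrix. Equal indices get [p - 1] rather than [p] because the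
    equation [rtt] already contains that term once with coefficient one. *)
Definition rtt_coef (i j : nat) : K :=
  if (i < j)%N then p - p^-1 else if i == j then p - 1 else 0.

(* For p = q^2 these equations, over all indices, are equivalent to the four
   families of relations; stated uniformly, they pass to matrix products. *)
Definition rtt m n (Z : 'I_m -> 'I_n -> V -> V) := forall i s j t f,
  Z s j (Z i t f) + rtt_coef i s *: Z i j (Z s t f) =
  Z i t (Z s j f) + rtt_coef j t *: Z i j (Z s t f).

Definition mxop l m n (X : 'I_l -> 'I_m -> {linear V -> V})
    (Y : 'I_m -> 'I_n -> {linear V -> V}) i j (f : V) : V :=
  \sum_a X i a (Y a j f).

Lemma mxop_is_linear l m n X Y i j : linear (@mxop l m n X Y i j).
Proof.
move=> a f g; rewrite /mxop scaler_sumr -big_split /=; apply: eq_bigr => k _.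
by rewrite !linearP.
Qed.
HB.instance Definition _ l m n X Y i j :=
  GRing.isLinear.Build K V V *:%R (@mxop l m n X Y i j) (mxop_is_linear X Y i j).

(** The equation for [X] trades the coefficient of [i, s] for one of the inner indices [a, b]; after
    the inner indices are exchanged in the other sum, the equation for [Y] trades it for the
    coefficient of [j, t]. *)
Lemma rtt_mxop l m n (X : 'I_l -> 'I_m -> {linear V -> V})
    (Y : 'I_m -> 'I_n -> {linear V -> V}) :
    rtt (fun i j => X i j) -> rtt (fun i j => Y i j) ->
    (forall i a b j f, Y b j (X i a f) = X i a (Y b j f)) ->
  rtt (mxop X Y).
Proof.
move=> rX rY XY i s j t f.
have mE i1 j1 i2 j2 : mxop X Y i1 j1 (mxop X Y i2 j2 f) =
    \sum_a \sum_b X i1 a (X i2 b (Y a j1 (Y b j2 f))).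
  rewrite {1}/mxop; apply: eq_bigr => a _; rewrite /mxop !raddf_sum /=.
  by apply: eq_bigr => b _; rewrite XY.
rewrite !mE !scaler_sumr -!big_split /=.
transitivity (\sum_a \sum_b X i b (X s a (Y a j (Y b t f))) +
    \sum_(a < m) \sum_(b < m) rtt_coef a b *: X i a (X s b (Y a j (Y b t f)))).
  rewrite -big_split; apply: eq_bigr => a _ /=.
  rewrite scaler_sumr -!big_split; apply: eq_bigr => b _ /=; exact: rX.
rewrite exchange_big -big_split; apply: eq_bigr => a _ /=.
rewrite scaler_sumr -!big_split; apply: eq_bigr => b _ /=.
have /(congr1 (fun v => X i a (X s b v))) := rY a b j t f.
by rewrite /= !linearD !linearZ.
Qed.

Section Consequences.
Variables (m n : nat) (Z : 'I_m -> 'I_n -> V -> V).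
Hypothesis rttZ : rtt Z.

Let scaleP (x y : V) :
  x + (p - 1) *: x = y + (p - p^-1) *: x -> x = p *: y.
Proof.
move/esym/(canRL (addrK _)) => ->.
rewrite -addrA -scaleNr -scalerDl -[X in X + _]scale1r -scalerDl scalerA.
by rewrite opprB addrA [1 + _]addrC subrK [p + _]addrC subrK mulfV ?scale1r.
Qed.

Lemma rtt_row (i : 'I_m) (j k : 'I_n) f : (j < k)%N ->
  Z i j (Z i k f) = p *: Z i k (Z i j f).
Proof.
move=> jk; apply: scaleP.
by have := rttZ i i j k f; rewrite /rtt_coef ltnn eqxx jk.
Qed.

Lemma rtt_col (i k : 'I_m) (j : 'I_n) f : (i < k)%N ->
  Z i j (Z k j f) = p *: Z k j (Z i j f).
Proof.
move=> ik; have := rttZ i k j j f; rewrite /rtt_coef ltnn eqxx ik => /esym.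
exact: scaleP.
Qed.

(** Here both coefficients equal [p - p^-1] and multiply the same term, which cancels. *)
Lemma rtt_comm (i s : 'I_m) (j t : 'I_n) f : (s < i)%N -> (j < t)%N ->
  Z i j (Z s t f) = Z s t (Z i j f).
Proof.
by move=> si jt; have := rttZ s i j t f; rewrite /rtt_coef si jt => /addIr.
Qed.

Lemma rtt_diag (i s : 'I_m) (j t : 'I_n) f : (i < s)%N -> (j < t)%N ->
  Z i j (Z s t f) = Z s t (Z i j f) + (p - p^-1) *: Z i t (Z s j f).
Proof.
move=> si jt; have := rttZ s i j t f; rewrite /rtt_coef ltnNge ltnW //=.
by rewrite gtn_eqF // jt scale0r addr0 => ->; rewrite (rtt_comm f si jt).
Qed.

End Consequences.

End RTT.

Section OqAction.
Variables (K : fieldType) (q : K) (n : nat) (V : lmodType K).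
Variable Z : 'I_n -> 'I_n -> {linear V -> V}.
Hypotheses (q_neq0 : q != 0) (rttZ : rtt (q ^+ 2) (fun i j => Z i j)).

Let T (ij : 'I_n * 'I_n) := Z ij.1 ij.2.

Definition oq_act (f : V) (x : Oq q n) : V := falg_act T f (tsrepr x).

Lemma falg_act_rel f (r : freeZ K n) :
  Oq_rel q (@freeZgen K n) r -> falg_act T f r = 0.
Proof.
have p0 : q ^+ 2 != 0 by rewrite expf_neq0.
have aM i j s t : falg_act T f (freeZgen K i j * freeZgen K s t) = Z i j (Z s t f).
  by rewrite /freeZgen falg_actM !falg_act_gen.
have aB (x y : freeZ K n) :
    falg_act T f (x - y) = falg_act T f x - falg_act T f y.
  exact: raddfB.
have aD (x y : freeZ K n) :
    falg_act T f (x + y) = falg_act T f x + falg_act T f y.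
  exact: raddfD.
have aZ c (x : freeZ K n) : falg_act T f (c *: x) = c *: falg_act T f x.
  exact: linearZ.
have aR i j s t k l u v c :
    falg_act T f (freeZgen K i j * freeZgen K s t -
                  c *: (freeZgen K k l * freeZgen K u v)) =
    Z i j (Z s t f) - c *: Z k l (Z u v f).
  by rewrite aB aZ; congr (_ - _ *: _); apply: aM.
have aS (x y : V) : x = y -> x - y = 0 by move=> ->; rewrite subrr.
case=> [i j k jk|i j k ik|i j s t si jt|i j s t si jt].
- by rewrite aR; apply/aS/(rtt_row p0 rttZ i f jk).
- by rewrite aR; apply/aS/(rtt_col p0 rttZ j f ik).
- rewrite -[freeZgen K s t * _]scale1r aR scale1r; apply: aS.
  exact: (rtt_comm rttZ f si jt).
rewrite opprD addrA aB -[freeZgen K s t * _]scale1r aR scale1r aZ.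
rewrite -addrA -opprD; apply: aS; rewrite (rtt_diag rttZ f si jt).
congr (_ + _ *: _); exact/esym/aM.
Qed.

(** A relator [r] kills every vector, in particular the image of [f] under [v], so each [u * r * v]
    acts by zero and the action descends to the quotient. *)
Lemma oq_act_pi f x : oq_act f (tspi (@freeZ_proper K q n) x) = falg_act T f x.
Proof.
rewrite /oq_act; have := tsideal_repr (@freeZ_proper K q n) x.
set y := tsrepr _ => I; apply/eqP; rewrite -subr_eq0 -raddfB /=; apply/eqP.
elim: I => [|u r v z rr _ IH]; first exact: raddf0.
by rewrite raddfD /= IH !falg_actM (falg_act_rel _ rr) falg_act0 addr0.
Qed.

Lemma oq_act_is_linear f : linear (oq_act f).
Proof.
move=> a x y; rewrite -[x]tsreprK -[y]tsreprK -linearP !oq_act_pi.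
exact: linearP.
Qed.

Lemma oq_actM f x y : oq_act f (x * y) = oq_act (oq_act f y) x.
Proof.
by rewrite -[x]tsreprK -[y]tsreprK -rmorphM !oq_act_pi falg_actM.
Qed.

Lemma oq_act1 f : oq_act f 1 = f.
Proof. by rewrite -(rmorph1 (tspi (@freeZ_proper K q n))) oq_act_pi falg_act1. Qed.

Lemma oq_act_gen f i j : oq_act f (Zgen q i j) = Z i j f.
Proof. by rewrite oq_act_pi /freeZgen falg_act_gen. Qed.

End OqAction.

(** * The path representation *)

Section PathOperators.
Variables (K : fieldType) (p : K).
Hypothesis p_neq0 : p != 0.

(* Exponents of the variables x_(r, j), "step of the r-th factor into column j",
   together with the weight, which counts r for each x_(r, j). *)
Definition pstate : Type := ((nat -> nat -> nat) * nat)%type.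
Local Notation V := (pstate -> K^o).
Implicit Types (f : V) (s : pstate).

Definition bump_at (r j : nat) s : pstate :=
  ((fun r' j' => ((r' == r) && (j' == j)) + s.1 r' j')%N, (s.2 + r)%N).

(** Within factor [r], the diagonal entry [j] acquires a power of [p] against exactly two steps: the
    one into column [j], its neighbour in the same column, and the one into column [j.+1], its
    neighbour in the same row. *)
Definition twist (r j : nat) s : K := p ^+ s.1 r j / p ^+ s.1 r j.+1.

Definition bidiag (r i j : nat) f : V := fun s =>
  if i == j then twist r j s * f s
  else if i.+1 == j then f (bump_at r j s) else 0.

Lemma bidiag_is_linear r i j : linear (bidiag r i j).
Proof.
move=> a f g; apply/funext => s; rewrite /bidiag !fctE.
case: eqP => _; first by rewrite mulrDr /GRing.scale /= mulrCA.
by case: eqP => _; rewrite ?scaler0 ?addr0.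
Qed.
HB.instance Definition _ r i j :=
  GRing.isLinear.Build K V V *:%R (bidiag r i j) (bidiag_is_linear r i j).

Lemma bump_atC r j r' j' s :
  bump_at r j (bump_at r' j' s) = bump_at r' j' (bump_at r j s).
Proof.
by congr pair; [apply/funext => a; apply/funext => b; rewrite addnCA | rewrite addnAC].
Qed.

Lemma twist_bump r j r' j' s : twist r j (bump_at r' j' s) =
  p ^+ ((r == r') && (j == j')) / p ^+ ((r == r') && (j.+1 == j')) * twist r j s.
Proof. by rewrite /twist /= !exprD invfM mulrACA. Qed.

Lemma bidiag_comm r r' i j i' j' f : r != r' ->
  bidiag r i j (bidiag r' i' j' f) = bidiag r' i' j' (bidiag r i j f).
Proof.
move=> rr; apply/funext => s; rewrite /bidiag.
have rr' : r' != r by rewrite eq_sym.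
case: (i == j); case: (i' == j'); [| case: (i'.+1 == j') | case: (i.+1 == j)
  | case: (i'.+1 == j'); case: (i.+1 == j)];
  rewrite ?twist_bump ?(negPf rr) ?(negPf rr') ?mulr0 ?divr1 ?mul1r //.
- by rewrite mulrCA.
- by rewrite bump_atC.
Qed.

Lemma bidiag_rtt r (i s j t : nat) (f : pstate -> K) :
  bidiag r s j (bidiag r i t f) +
    rtt_coef p i s *: (bidiag r i j (bidiag r s t f) : V) =
  bidiag r i t (bidiag r s j f) +
    rtt_coef p j t *: (bidiag r i j (bidiag r s t f) : V).
Proof.
have p0 := negPf p_neq0.
apply/funext => x; rewrite !fctE /rtt_coef /bidiag /GRing.scale /=.
(* All coincidences among the indices and their successors are enumerated. The consistent cases
   reduce to the commutation of two steps or to a rational identity in [p] and the twists. *)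
case: (eqVneq i j) => ij; case: (eqVneq i.+1 j) => ij1;
case: (eqVneq s j) => sj; case: (eqVneq s.+1 j) => sj1;
case: (eqVneq i t) => it; case: (eqVneq i.+1 t) => it1;
case: (eqVneq s t) => st; case: (eqVneq s.+1 t) => st1;
try (exfalso; lia);
case: (ltngtP i s) => is_; case: (ltngtP j t) => jt;
try (exfalso; lia); subst; rewrite ?twist_bump ?eqxx ?eqSS /=;
rewrite ?(gtn_eqF (ltnSn _)) ?(ltn_eqF (ltnSn _)) ?mulr0 ?mulr0n ?expr0 ?expr1;
repeat match goal with H : is_true (?a != ?b) |- _ =>
  rewrite ?(negPf H) ?[b == a]eq_sym ?(negPf H); clear H end;
rewrite ?mulr0n ?expr0 ?divr1 ?mul1r ?mul0r //;
try by rewrite bump_atC.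
all: by field; rewrite ?(negbT p0).
Qed.

Definition delta_op (i j : nat) f : V := if i == j then f else 0.

Lemma delta_op_is_linear i j : linear (delta_op i j).
Proof. by move=> a f g; rewrite /delta_op; case: eqP; rewrite ?scaler0 ?addr0. Qed.
HB.instance Definition _ i j :=
  GRing.isLinear.Build K V V *:%R (delta_op i j) (delta_op_is_linear i j).

Section Paths.
Variable m : nat.

Fixpoint path_op (r : nat) : 'I_m -> 'I_m -> {linear V -> V} :=
  if r is r'.+1 then fun i j =>
    mxop (path_op r') (fun a b : 'I_m => bidiag r' a b : {linear V -> V}) i j
  else fun i j => delta_op i j : {linear V -> V}.

Lemma path_opS r i j f :
  path_op r.+1 i j f = \sum_a path_op r i a (bidiag r a j f).
Proof. by []. Qed.

(** The product [path_op r] only involves the factors numbered below [r], and distinct factors act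
    on disjoint sets of variables. *)
Lemma path_op_comm r r' (i j : 'I_m) (a b : nat) f : (r <= r')%N ->
  bidiag r' a b (path_op r i j f) = path_op r i j (bidiag r' a b f).
Proof.
elim: r i j f => [|r IH] i j f rr'.
  by rewrite /= /delta_op; case: eqP; rewrite ?linear0.
rewrite !path_opS raddf_sum /=; apply: eq_bigr => k _.
by rewrite IH 1?ltnW // bidiag_comm // gtn_eqF.
Qed.

Lemma rtt_path r : rtt p (fun i j => path_op r i j).
Proof.
elim: r => [|r IH].
  move=> i s j t f /=; rewrite /delta_op /rtt_coef.
  case: (ltngtP i s) => is_; case: (ltngtP j t) => jt;
  case: (eqVneq (i : nat) j) => ij; case: (eqVneq (s : nat) t) => st;
  case: (eqVneq (i : nat) t) => it; case: (eqVneq (s : nat) j) => sj;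
  try (exfalso; lia); by rewrite ?scaler0.
apply: rtt_mxop => //.
  by move=> i s j t f; apply: bidiag_rtt.
by move=> i a b j f; apply: path_op_comm.
Qed.

End Paths.

End PathOperators.

(** * Leading terms of operators *)

Section Lead.
Variable K : fieldType.
Local Notation V := (pstate -> K^o).
Implicit Types (f : V) (s : pstate) (T : V -> V).

Definition shift (u : nat -> nat -> nat) (w : nat) s : pstate :=
  ((fun r c => u r c + s.1 r c)%N, (s.2 + w)%N).

Definition vanish_above (w : nat) f := forall s, (w < s.2)%N -> f s = 0.

(* T f s only sees f at weights >= s.2 + w, and at weight s.2 + w only at the
   state shifted by u: the triangularity behind linear independence. *)
Definition lead (T : V -> V) u w := exists2 k : pstate -> K,
  forall s, k s != 0 &
  forall f s, vanish_above (s.2 + w) f -> T f s = k s * f (shift u w s).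

Definition deep (T : V -> V) w := forall f s, vanish_above (s.2 + w) f -> T f s = 0.

Lemma lead_deep T u w w' : lead T u w -> (w' < w)%N -> deep T w'.
Proof.
case=> k _ Tk ww f s f0; rewrite Tk => [|s' ?]; last by apply: f0; lia.
by rewrite f0 ?mulr0 //= ltn_add2l.
Qed.

Lemma eq_lead T T' u w : T =1 T' -> lead T u w -> lead T' u w.
Proof. by move=> TT' [k k0 Tk]; exists k => // f s f0; rewrite -TT' Tk. Qed.

Lemma lead_id : lead id (fun _ _ => 0%N) 0.
Proof.
exists (fun _ => 1) => [s|f s _]; first exact: oner_neq0.
by rewrite mul1r /shift addn0; case: s.
Qed.

Lemma lead_comp T T' u u' w w' : lead T u w -> lead T' u' w' ->
  lead (T \o T') (fun r c => u r c + u' r c)%N (w + w').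
Proof.
case=> k k0 Tk [k' k0' Tk'].
exists (fun s => k s * k' (shift u w s)) => [s|f s f0]; first by rewrite mulf_neq0.
(* The function [T' f] vanishes above weight [s.2 + w]: at such a state the leading term of [T']
   reads [f] above weight [s.2 + (w + w')]. *)
rewrite /= Tk => [|s' ss']; last first.
  rewrite Tk' => [|s'' ?]; last by apply: f0; lia.
  by rewrite f0 ?mulr0 //= addnA ltn_add2r.
rewrite Tk' => [|s' ss']; last by apply: f0; move: ss'; rewrite /= addnA.
rewrite mulrA; congr (_ * f _); rewrite /shift /= addnA; congr pair.
by apply/funext => r; apply/funext => c; lia.
Qed.

Lemma lead_sum (I : finType) (T : I -> V -> V) i u w :
  lead (T i) u w -> (forall j, j != i -> deep (T j) w) ->
  lead (fun f => \sum_j T j f) u w.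
Proof.
case=> k k0 Tk dT; exists k => // f s f0.
rewrite (bigD1 i) //= !fctE Tk // fct_sumE big1 ?addr0 // => j ji.
by rewrite dT.
Qed.

End Lead.

Section LeadingTerms.
Variables (K : fieldType) (p : K).
Hypothesis p_neq0 : p != 0.
Local Notation V := (pstate -> K^o).

Lemma lead_twist r j : lead (bidiag p r j j) (fun _ _ => 0%N) 0.
Proof.
exists (twist p r j) => [s|f s _].
  by rewrite mulf_neq0 ?invr_eq0 ?expf_neq0.
by rewrite /bidiag eqxx /shift addn0; case: s.
Qed.

Lemma lead_step r j :
  lead (bidiag p r j j.+1) (fun r' c => (r' == r) && (c == j.+1) : nat) r.
Proof.
exists (fun=> 1) => [s|f s _]; first exact: oner_neq0.
by rewrite /bidiag ltn_eqF // eqxx mul1r.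
Qed.

(* The lightest path from row i to column j steps into column c at time
   c - i - 1, for i < c <= j. *)
Definition path_exp (i j r c : nat) : nat := (i < c <= j)%N && (r == c - i.+1)%N.
Definition path_wt (i j : nat) : nat := (\sum_(k < j - i) k)%N.

Variable m : nat.
Local Notation W r := (@path_op K p m r).

(** A path never moves left and moves right by at most one column per factor. *)
Lemma path_op_eq0 r (i j : 'I_m) f : (j < i)%N || (i + r < j)%N -> W r i j f = 0.
Proof.
elim: r i j f => [|r IH] i j f ij.
  by rewrite /= /delta_op; case: eqP => // ji; exfalso; lia.
rewrite path_opS big1 // => a _.
have [aj|] := eqVneq (a : nat) j; first by rewrite IH //; lia.
have [aj _|aj ja] := eqVneq a.+1 (j : nat); first by rewrite IH //; lia.
suff -> : bidiag p r a j f = 0 by rewrite linear0.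
by apply/funext => s; rewrite /bidiag (negPf aj) (negPf ja).
Qed.

(** Induction on the last factor. If [j] is within reach of the first [r] factors, the lightest path
    ends with a twist: a step at time [r] into [j] from [a = j - 1] would add [r], more than the
    [a - i] counted in [path_wt i j]. If [j = i + r.+1], every factor has to be a step. *)
Lemma lead_path r (i j : 'I_m) : (i <= j <= i + r)%N ->
  lead (W r i j) (path_exp i j) (path_wt i j).
Proof.
elim: r i j => [|r IH] i j ij.
  have ji : (j : nat) = i by lia.
  have -> : path_exp i j = (fun _ _ => 0%N).
    by apply/funext => a; apply/funext => c; rewrite /path_exp; lia.
  rewrite /path_wt ji subnn big_ord0; apply: eq_lead (lead_id K) => f.
  by rewrite /= /delta_op ji eqxx.
have S (a : 'I_m) : a.+1 = j :> nat -> (i <= a)%N -> (j <= i + r.+1)%N ->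
    lead (W r i a \o bidiag p r a j)
      (fun r' c => path_exp i a r' c + ((r' == r) && (c == a.+1) : nat))%N
      (path_wt i a + r).
  move=> aj ia jr; apply: lead_comp; first by apply: IH; lia.
  by rewrite -aj; apply: lead_step.
have wS (a : 'I_m) : a.+1 = j :> nat -> (i <= a)%N ->
    path_wt i j = (path_wt i a + (a - i))%N.
  by move=> <- ia; rewrite /path_wt subSn // big_ord_recr.
apply: (@eq_lead _ (fun f => \sum_a (W r i a \o bidiag p r a j) f)) => [f|].
  by [].
have dz (a : 'I_m) w : a.+1 != j :> nat -> a != j :> nat ->
    deep (W r i a \o bidiag p r a j) w.
  move=> aj ja f s _ /=; suff -> : bidiag p r a j f = 0 by rewrite linear0.
  by apply/funext => s'; rewrite /bidiag (negPf aj) (negPf ja).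
have [jr|jr] := leqP j (i + r).
  apply: (@lead_sum _ _ _ j) => [|a aj].
    have -> : path_exp i j = (fun r c => path_exp i j r c + 0)%N.
      by apply/funext => a; apply/funext => c; rewrite addn0.
    rewrite -[path_wt i j]addn0.
    apply: (@lead_comp _ _ (bidiag p r j j) (path_exp i j) (fun _ _ => 0%N)).
      by apply: IH; lia.
    exact: lead_twist.
  have [aj1|aj1] := eqVneq a.+1 (j : nat); last by apply: dz.
  have [ia|ai] := leqP i a; last first.
    by move=> f s _ /=; rewrite path_op_eq0 ?ai.
  by apply: lead_deep (S a aj1 ia _) _; rewrite ?(wS a) //; lia.
have jm : (j.-1 < m)%N by have := ltn_ord j; lia.
pose a0 := Ordinal jm; have aj0 : a0.+1 = j :> nat by rewrite /=; lia.
have ia0 : (i <= a0)%N by rewrite /=; lia.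
apply: (@lead_sum _ _ _ a0) => [|a aj].
  have -> : path_exp i j =
      (fun r' c => path_exp i a0 r' c + ((r' == r) && (c == a0.+1) : nat))%N.
    by apply/funext => a; apply/funext => c; rewrite /path_exp /=; lia.
  rewrite (wS a0) // (_ : (a0 - i)%N = r); last by rewrite /=; lia.
  by apply: S => //; lia.
have [aj1|aj1] := eqVneq (a : nat) j; last first.
  by apply: dz => //; apply: contraNneq aj => e; apply/eqP/val_inj => /=; lia.
by move=> f s _ /=; rewrite path_op_eq0 // aj1 jr orbT.
Qed.

End LeadingTerms.

(** * Linear independence of the monomials *)

Section PBWIndependence.
Variables (K : fieldType) (q : K) (n : nat).
Hypothesis q_neq0 : q != 0.
Local Notation V := (pstate -> K^o).
Local Notation p := (q ^+ 2).

Let p_neq0 : p != 0. Proof. exact: expf_neq0. Qed.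

(** With rows in the first half and columns in the second, [i < n + j] always holds, so every
    lightest path does step into its column [n + j]; it has at most [n + n] steps, one for each
    factor. *)
Definition path_gen (i j : 'I_n) : {linear V -> V} :=
  @path_op K p (n + n) (n + n) (lshift n i) (rshift n j).

Lemma rtt_path_gen : rtt p (fun i j => path_gen i j).
Proof.
move=> i s j t f.
have := rtt_path p_neq0 (n + n) (lshift n i) (lshift n s) (rshift n j) (rshift n t) f.
by rewrite /= [rtt_coef p (n + j) _]/rtt_coef ltn_add2l eqn_add2l.
Qed.

Let act (x : Oq q n) : V -> V := fun f => oq_act path_gen f x.

Lemma lead_act_prod (I : Type) (s : seq I) (F : I -> Oq q n) u w :
  (forall i, lead (act (F i)) (u i) (w i)) ->
  lead (act (\prod_(i <- s) F i)) (fun r c => \sum_(i <- s) u i r c)%N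
    (\sum_(i <- s) w i)%N.
Proof.
move=> Fl; elim: s => [|i s IH].
  rewrite !big_nil (_ : (fun _ _ => _) = (fun _ _ => 0%N)); last first.
    by apply/funext => a; apply/funext => b; rewrite big_nil.
  by apply: eq_lead (lead_id K) => f; rewrite /act oq_act1 //; apply: rtt_path_gen.
rewrite !big_cons (_ : (fun _ _ => _) =
    (fun r c => u i r c + \sum_(k <- s) u k r c)%N); last first.
  by apply/funext => a; apply/funext => b; rewrite big_cons.
apply: eq_lead (lead_comp (Fl i) IH) => f; rewrite /act oq_actM //.
exact: rtt_path_gen.
Qed.

Definition mon_exp (A : 'M[nat]_n) r c : nat :=
  (\sum_i \sum_j \sum_(k < A i j) path_exp i (n + j) r c)%N.
Definition mon_wt (A : 'M[nat]_n) : nat :=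
  (\sum_i \sum_j \sum_(k < A i j) path_wt i (n + j))%N.

Lemma lead_Zmon A : lead (act (Zmon q A)) (mon_exp A) (mon_wt A).
Proof.
apply: lead_act_prod => i; apply: lead_act_prod => j.
have -> : Zgen q i j ^+ A i j = \prod_(k < A i j) Zgen q i j.
  by rewrite prodr_const card_ord.
apply: lead_act_prod => _.
have := lead_path p_neq0 (r := n + n) (i := lshift n i) (j := rshift n j).
move=> /= H; have {}H := H _; apply: eq_lead (H _) => [f|].
  by rewrite /act oq_act_gen //; apply: rtt_path_gen.
by have := ltn_ord i; have := ltn_ord j; lia.
Qed.

(** A lightest path from row [i] enters column [n + j] at time [n + j - i.+1], which determines [i].
    The exponent there is therefore the tail sum of row [i] from column [j] on, and differences of
    consecutive tails are the entries. *)
Lemma mon_exp_inj A B : mon_exp A = mon_exp B -> A = B.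
Proof.
move=> AB.
pose tail (C : 'M[nat]_n) (i : 'I_n) k := (\sum_(j < n | k <= j) C i j)%N.
have tailE C (i j : 'I_n) : mon_exp C (n + j - i.+1) (n + j) = tail C i j.
  rewrite /mon_exp (bigD1 i) //= [X in (_ + X)%N]big1 => [|i' ii].
    rewrite addn0 /tail [RHS]big_mkcond /=; apply: eq_bigr => j' _.
    rewrite sum_nat_const card_ord /path_exp eqxx andbT.
    have := ltn_ord i => ?; rewrite leq_add2l (_ : (i < n + j)%N); last by lia.
    by case: leqP => /=; rewrite ?muln1 ?muln0.
  apply: big1 => j' _; apply: big1 => k _; rewrite /path_exp.
  case: (_ == _) / eqP => [e|]; rewrite ?andbF ?andbT //.
  by exfalso; move/eqP: ii; apply; apply/val_inj => /=; have := ltn_ord i; have := ltn_ord i'; lia.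
have tailS C (i j : 'I_n) : tail C i j = (C i j + tail C i j.+1)%N.
  rewrite /tail (bigD1 j) //=; congr (_ + _)%N; apply: eq_bigl => k.
  by rewrite ltn_neqAle eq_sym andbC.
have tAB i k : tail A i k = tail B i k.
  have [kn|nk] := ltnP k n; first by have := tailE A i (Ordinal kn); rewrite AB tailE.
  by rewrite /tail !big1 // => j; have := ltn_ord j; lia.
apply/matrixP => i j; have := tailS A i j; rewrite !tAB tailS => /addIn ->.
by [].
Qed.

Lemma Zmon_free (c : {malg K['M[nat]_n]}) : malg_lift (Zmon q) c = 0 -> c = 0.
Proof.
move=> c0; apply: contrapT => cn0.
have [A Ac Amin] : exists2 A, A \in msupp c &
    forall B, B \in msupp c -> (mon_wt A <= mon_wt B)%N.
  have exw : exists k, has (fun A => mon_wt A == k) (msupp c).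
    apply: contrapT => H; apply: cn0; apply/malgP => A; rewrite mcoeff0.
    apply/mcoeff_outdom/negP => Ac; apply: H; exists (mon_wt A).
    by apply/hasP; exists A.
  case: (ex_minnP exw) => k /hasP[A Ac /eqP Ak] kmin; exists A => // B Bc.
  by rewrite Ak; apply: kmin; apply/hasP; exists B.
pose s0 : pstate := (fun _ _ => 0%N, 0%N).
(* The test function is supported at the state where the leading term of [Z^A] at [s0] reads. Any
   other [B] in the support of [c] is at least as heavy as [A], so at [s0] only its leading term can
   see [f], and it reads a state with different exponents. *)
pose f : V := fun s => (`[< s = shift (mon_exp A) (mon_wt A) s0 >])%:R.
have f0 : vanish_above (mon_wt A) f.
  by move=> s; rewrite /f; case: asboolP => // -> /=; rewrite add0n ltnn.
have [g gE] : exists g : {linear Oq q n -> V}, forall x, g x = act x f.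
  pose L := GRing.isLinear.Build _ _ _ _ _ (oq_act_is_linear q_neq0 rtt_path_gen f).
  by exists (HB.pack_for {linear Oq q n -> V} (oq_act path_gen f) L).
have : g (malg_lift (Zmon q) c) s0 = 0 by rewrite c0 linear0.
rewrite /malg_lift linear_sum fct_sumE (big_fsetD1 A) //= big_seq big1.
  rewrite addr0 linearZ gE /= -[_ s0]/(mcoeff A c * act (Zmon q A) f s0).
  have [k k0 ->] := lead_Zmon A.
    rewrite /f asboolT // mulr1; move/eqP; rewrite mulf_eq0 (negPf (k0 _)) orbF.
    by apply/negP; rewrite mcoeff_neq0.
  by move=> s; rewrite add0n; apply: f0.
move=> B /fsetD1P[BA Bc]; rewrite linearZ gE /= -[LHS]/(mcoeff B c * act (Zmon q B) f s0).
have [k k0 ->] := lead_Zmon B.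
  rewrite /f asboolF ?mulr0 ?scaler0 //; case=> uBA _.
  move/eqP: BA; apply; apply: mon_exp_inj; apply/funext => r; apply/funext => j.
  by move/(congr1 (fun h => h r j)): uBA; rewrite !addn0.
by move=> s sB; apply: f0; apply: leq_ltn_trans sB; rewrite add0n Amin.
Qed.
End PBWIndependence.

(** * Straightening words *)

Section Span.
Variables (K : fieldType) (M : choiceType) (V : lmodType K) (v : M -> V).
Implicit Types (S : K -> Prop) (F : {fset M}) (x : V).

Definition subring_prop S :=
  [/\ S 1, forall a b, S a -> S b -> S (a - b) & forall a b, S a -> S b -> S (a * b)].

Lemma subring0 S : subring_prop S -> S 0.
Proof. by case=> S1 SB _; rewrite -(subrr 1); apply: SB. Qed.

Lemma subringN S a : subring_prop S -> S a -> S (- a).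
Proof. by move=> rS Sa; rewrite -sub0r; case: (rS) => _ SB _; apply: SB => //; apply: subring0. Qed.

Lemma subringD S a b : subring_prop S -> S a -> S b -> S (a + b).
Proof.
by move=> rS Sa Sb; rewrite -[b]opprK; case: (rS) => _ SB _; apply: SB => //; apply: subringN.
Qed.

(** The coefficient ring is the parameter [S], so that one set of lemmas serves Z[q, q^-1] in the
    straightening and Z[q] in the lattice. *)
Definition fspan S F x := exists c : M -> K,
  (forall B, S (c B)) /\ x = \sum_(B <- F) c B *: v B.

Variable S : K -> Prop.
Hypothesis rS : subring_prop S.

Lemma fspan0 F : fspan S F 0.
Proof.
exists (fun=> 0); split=> [_|]; first exact: subring0.
by rewrite big1 // => B _; rewrite scale0r.
Qed.

Lemma fspanD F x y : fspan S F x -> fspan S F y -> fspan S F (x + y).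
Proof.
case=> c [Sc ->] [d [Sd ->]]; exists (fun B => c B + d B); split=> [B|].
  exact: subringD.
by rewrite -big_split; apply: eq_bigr => B _; rewrite scalerDl.
Qed.

Lemma fspanZ F a x : S a -> fspan S F x -> fspan S F (a *: x).
Proof.
move=> Sa [c [Sc ->]]; exists (fun B => a * c B); split=> [B|].
  by case: rS => _ _; apply.
by rewrite scaler_sumr; apply: eq_bigr => B _; rewrite scalerA.
Qed.

Lemma fspanN F x : fspan S F x -> fspan S F (- x).
Proof. by rewrite -scaleN1r; apply: fspanZ => //; apply: subringN => //; case: rS. Qed.

Lemma fspanB F x y : fspan S F x -> fspan S F y -> fspan S F (x - y).
Proof. by move=> Fx Fy; apply/fspanD/fspanN. Qed.

Lemma fspan_mem F B : B \in F -> fspan S F (v B).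
Proof.
move=> BF; exists (fun C => (C == B)%:R); split=> [C|].
  by case: eqP => _; [case: rS | apply: subring0].
rewrite (big_fsetD1 B) //= eqxx scale1r big_seq big1 ?addr0 // => C.
by case/fsetD1P => /negPf -> _; rewrite scale0r.
Qed.

Lemma fspan_sum F (I : eqType) (r : seq I) (X : I -> V) :
  (forall i, i \in r -> fspan S F (X i)) -> fspan S F (\sum_(i <- r) X i).
Proof.
move=> FX; rewrite big_seq; elim/big_ind: _ => //; first exact: fspan0.
exact: fspanD.
Qed.

Lemma fspan_sub F F' x : {subset F <= F'} -> fspan S F x -> fspan S F' x.
Proof.
move=> FF' [c [Sc ->]]; apply: fspan_sum => B BF.
by apply: fspanZ => //; apply/fspan_mem/FF'.
Qed.

End Span.

(** * Polynomial and Laurent coefficients *)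

Section ZqVal.
Variables (K : fieldType) (q : K).

HB.instance Definition _ := GRing.RMorphism.copy (Zq_val q)
  (horner_eval q \o map_poly intr).

Lemma Zq_valX : Zq_val q 'X = q.
Proof. by rewrite /Zq_val map_polyX hornerX. Qed.

Definition Zq_prop (a : K) := exists f, a = Zq_val q f.

Definition laurent (a : K) := exists k f, a = q ^- k * Zq_val q f.

Lemma subring_Zq : subring_prop Zq_prop.
Proof.
split=> [|_ _ [f ->] [g ->]|_ _ [f ->] [g ->]]; first by exists 1; rewrite rmorph1.
- by exists (f - g); rewrite rmorphB.
- by exists (f * g); rewrite rmorphM.
Qed.

Hypothesis q_neq0 : q != 0.

Lemma subring_laurent : subring_prop laurent.
Proof.
split=> [|_ _ [k [f ->]] [l [g ->]]|_ _ [k [f ->]] [l [g ->]]].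
- by exists 0, 1; rewrite rmorph1 expr0 invr1 mulr1.
- exists (k + l)%N, ('X ^+ l * f - 'X ^+ k * g).
  rewrite rmorphB !rmorphM !rmorphXn /= Zq_valX exprD invfM mulrBr !mulrA.
  by rewrite mulfVK ?expf_neq0 // [q ^- k / _]mulrC mulfVK ?expf_neq0.
- exists (k + l)%N, (f * g).
  by rewrite rmorphM exprD invfM mulrACA.
Qed.

Lemma Zq_laurent a : Zq_prop a -> laurent a.
Proof. by case=> f ->; exists 0, f; rewrite expr0 invr1 mul1r. Qed.

Lemma laurentX k : laurent (q ^+ k).
Proof. by exists 0, ('X ^+ k); rewrite rmorphXn /= Zq_valX expr0 invr1 mul1r. Qed.

Lemma laurentV k : laurent (q ^- k).
Proof. by exists k, 1; rewrite rmorph1 mulr1. Qed.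

End ZqVal.

Lemma lower_ind (M : choiceType) (lower : M -> {fset M}) (rank : M -> nat)
    (rankP : forall A B, B \in lower A -> (rank B < rank A)%N) (P : M -> Prop) :
  (forall A, (forall B, B \in lower A -> P B) -> P A) -> forall A, P A.
Proof.
move=> PI A; have [k] := ubnP (rank A); elim: k A => // k IH A /ltnSE Ak.
by apply: PI => B /rankP BA; apply: IH; apply: leq_trans Ak.
Qed.

(** * The lexicographic order with fixed row and column sums *)

Section Below.
Variable n : nat.
Implicit Types A B C : 'M[nat]_n.

Lemma pos_lt_trans (i j k l s t : 'I_n) :
  pos_lt i j k l -> pos_lt k l s t -> pos_lt i j s t.
Proof. by rewrite /pos_lt -!val_eqE /=; lia. Qed.

Lemma pos_lt_total (i j k l : 'I_n) :
  [|| pos_lt i j k l, (i == k) && (j == l) | pos_lt k l i j].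
Proof. by rewrite /pos_lt -!val_eqE /=; lia. Qed.

Lemma mx_ltP B A : reflect (exists i j, (B i j < A i j)%N /\
    forall k l, pos_lt k l i j -> B k l = A k l) (mx_lt B A).
Proof.
apply: (iffP existsP) => [[i /existsP[j /andP[lt eq]]]|[i [j [lt eq]]]].
  exists i, j; split=> // k l kl; apply/eqP.
  by move/forallP/(_ k)/forallP/(_ l)/implyP: eq; apply.
exists i; apply/existsP; exists j; rewrite lt /=.
by apply/forallP => k; apply/forallP => l; apply/implyP => /eq ->.
Qed.

Lemma mx_lt_irr A : ~~ mx_lt A A.
Proof. by apply/mx_ltP => -[i [j []]]; rewrite ltnn. Qed.

Lemma mx_lt_trans B A C : mx_lt A B -> mx_lt B C -> mx_lt A C.
Proof.
move=> /mx_ltP[i [j [AB eAB]]] /mx_ltP[k [l [BC eBC]]]; apply/mx_ltP.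
have /or3P[ij|/andP[/eqP eik /eqP ejl]|kl] := pos_lt_total i j k l.
- exists i, j; rewrite -eBC //; split=> // s t st.
  by rewrite eAB // eBC //; apply: pos_lt_trans st ij.
- exists i, j; subst; split; first exact: ltn_trans BC.
  by move=> s t st; rewrite eAB // eBC.
- exists k, l; rewrite eAB //; split=> // s t st.
  by rewrite eAB ?eBC //; apply: pos_lt_trans st kl.
Qed.

Definition fbelow A : {fset 'M[nat]_n} := fset_set (below A).

Lemma fbelowE A B : (B \in fbelow A) = [&& mx_lt B A, ro B == ro A & co B == co A].
Proof.
rewrite in_fset_set; last exact: finite_below.
by apply/idP/idP => [/set_mem|BA] //; apply: mem_set.
Qed.

Lemma fbelow_trans B A C : C \in fbelow B -> B \in fbelow A -> C \in fbelow A.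
Proof.
rewrite !fbelowE => /and3P[CB /eqP-> /eqP->] /and3P[BA -> ->].
by rewrite (mx_lt_trans CB BA).
Qed.

Lemma fbelow_irr A : A \notin fbelow A.
Proof. by rewrite fbelowE (negPf (mx_lt_irr A)). Qed.

(** Cardinality provides the rank for all later inductions: [fbelow B] is included in [fbelow A] by
    transitivity and misses [B] itself. *)
Lemma card_fbelow A B : B \in fbelow A -> (#|` fbelow B| < #|` fbelow A|)%N.
Proof.
move=> BA; apply: fproper_ltn_card; rewrite fproperE; apply/andP; split.
  by apply/fsubsetP => C CB; apply: fbelow_trans BA.
by apply/negP => /fsubsetP/(_ B BA); apply/negP/fbelow_irr.
Qed.

Lemma fbelow_ind (P : 'M[nat]_n -> Prop) :
  (forall A, (forall B, B \in fbelow A -> P B) -> P A) -> forall A, P A.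
Proof. by apply: (lower_ind (rank := fun A => #|` fbelow A|)) => A B; apply: card_fbelow. Qed.

End Below.

Lemma mulr_regroup (R : pzRingType) (a b c d : R) : a * (b * (c * d)) = a * (b * c) * d.
Proof. by rewrite !mulrA. Qed.

(** * Words in the generators modulo lower terms *)

Section Words.
Variables (K : fieldType) (q : K) (n : nat).
Hypothesis q_neq0 : q != 0.
Implicit Types (A B : 'M[nat]_n) (x y : 'I_n * 'I_n) (u v w : seq ('I_n * 'I_n)).

Lemma Zgen_row (i j k : 'I_n) : (j < k)%N ->
  Zgen q i j * Zgen q i k = q ^+ 2 *: (Zgen q i k * Zgen q i j).
Proof.
move=> jk; rewrite -!rmorphM -linearZ; apply/tspi_eq/tsideal_rel.
exact: OqRelRow.
Qed.

Lemma Zgen_col (i j k : 'I_n) : (i < k)%N ->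
  Zgen q i j * Zgen q k j = q ^+ 2 *: (Zgen q k j * Zgen q i j).
Proof.
move=> ik; rewrite -!rmorphM -linearZ; apply/tspi_eq/tsideal_rel.
exact: OqRelCol.
Qed.

Lemma Zgen_comm (i j s t : 'I_n) : (s < i)%N -> (j < t)%N ->
  Zgen q i j * Zgen q s t = Zgen q s t * Zgen q i j.
Proof.
move=> si jt; rewrite -!rmorphM; apply/tspi_eq/tsideal_rel.
exact: OqRelComm.
Qed.

Lemma Zgen_diag (i j s t : 'I_n) : (i < s)%N -> (j < t)%N ->
  Zgen q i j * Zgen q s t = Zgen q s t * Zgen q i j +
    (q ^+ 2 - q ^- 2) *: (Zgen q i t * Zgen q s j).
Proof.
move=> si jt; rewrite -!rmorphM -linearZ -rmorphD; apply/tspi_eq/tsideal_rel.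
exact: OqRelDiag.
Qed.

Definition Zword w : Oq q n := \prod_(x <- w) Zgen q x.1 x.2.

Definition content w : 'M[nat]_n := \matrix_(i, j) count_mem (i, j) w.

Lemma Zword_cat u v : Zword (u ++ v) = Zword u * Zword v.
Proof. exact: big_cat. Qed.

Lemma Zword_cons x u : Zword (x :: u) = Zgen q x.1 x.2 * Zword u.
Proof. exact: big_cons. Qed.

Lemma content_perm u v : perm_eq u v -> content u = content v.
Proof. by move/permP => uv; apply/matrixP => i j; rewrite !mxE uv. Qed.

Lemma sum_pred1 (k : 'I_n) : (\sum_(j < n) (k == j) = 1)%N.
Proof. by rewrite (bigD1 k) //= eqxx big1 // => j /negPf; rewrite eq_sym => ->. Qed.

Lemma ro_content w i : ro (content w) 0 i = count (fun x => x.1 == i) w.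
Proof.
rewrite mxE; under eq_bigr => j _ do rewrite mxE.
elim: w => [|[a b] w IH] /=; first by rewrite big1.
rewrite big_split /= IH; congr (_ + _)%N; under eq_bigr => j _ do rewrite xpair_eqE.
by case: (a == i) => /=; [rewrite sum_pred1 | rewrite big1].
Qed.

Lemma co_content w j : co (content w) 0 j = count (fun x => x.2 == j) w.
Proof.
rewrite mxE; under eq_bigr => i _ do rewrite mxE.
elim: w => [|[a b] w IH] /=; first by rewrite big1.
rewrite big_split /= IH; congr (_ + _)%N; under eq_bigr => i _ do rewrite xpair_eqE andbC.
by case: (b == j) => /=; [rewrite sum_pred1 | rewrite big1].
Qed.

(** Of the four entries that change, [(i, j)] comes first and drops by one; the letters keep the
    same row indices and the same column indices. *)
Lemma content_diag u v (i j s t : 'I_n) : (i < s)%N -> (j < t)%N ->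
  content (u ++ (i, t) :: (s, j) :: v) \in
    fbelow (content (u ++ (i, j) :: (s, t) :: v)).
Proof.
move=> si jt; rewrite fbelowE; apply/and3P; split.
- apply/mx_ltP; exists i, j; split=> [|k l]; rewrite !mxE !count_cat /= !xpair_eqE -!val_eqE /=.
    by lia.
  by rewrite /pos_lt -val_eqE /=; lia.
- by apply/eqP/rowP => k; rewrite !ro_content !count_cat.
- apply/eqP/rowP => k; rewrite !co_content !count_cat /=; lia.
Qed.

(** The pairs of letters whose exchange costs a factor [q^2]. *)
Definition qpair x y : bool := (x != y) && ((x.1 == y.1) || (x.2 == y.2)).

Definition lex_le x y := (x.1 < y.1)%N || (x.1 == y.1) && (x.2 <= y.2)%N.

Local Notation span A := (fspan (Znorm q) (laurent q) (fbelow A)).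

Let rL := subring_laurent q_neq0.

(* The induction hypothesis of the straightening: words of smaller content are
   already expressed, so word_swap only has to track the content A. *)
Section Straighten.
Variable A : 'M[nat]_n.
Hypothesis below_span : forall w, content w \in fbelow A -> span A (Zword w).

Let span_trans a b (X Y Z : Oq q n) : laurent q a ->
  span A (X - a *: Y) -> span A (Y - b *: Z) -> span A (X - (a * b) *: Z).
Proof.
move=> La XY /(fspanZ rL La) YZ; have := fspanD rL XY YZ.
by rewrite scalerBr scalerA addrA subrK.
Qed.

Let span_sym a (X Y : Oq q n) : a != 0 -> laurent q a^-1 ->
  span A (X - a *: Y) -> span A (Y - a^-1 *: X).
Proof.
move=> a0 La /(fspanZ rL La)/(fspanN rL); rewrite scalerBr scalerA mulVf //.
by rewrite scale1r opprB.
Qed.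

Lemma word_swap u v x y : lex_le x y -> content (u ++ x :: y :: v) = A ->
  span A (Zword (u ++ x :: y :: v) -
          q ^+ (2 * qpair x y) *: Zword (u ++ y :: x :: v)).
Proof.
move=> xy Aw.
have E a b : Zword (u ++ a :: b :: v) =
    Zword u * (Zgen q a.1 a.2 * Zgen q b.1 b.2) * Zword v.
  rewrite Zword_cat !Zword_cons; exact: mulr_regroup.
have Z (a b c d : 'I_n * 'I_n) e : Zgen q a.1 a.2 * Zgen q b.1 b.2 =
    e *: (Zgen q c.1 c.2 * Zgen q d.1 d.2) ->
    span A (Zword (u ++ a :: b :: v) - e *: Zword (u ++ c :: d :: v)).
  move=> ab; rewrite !E ab -scalerAr -scalerAl subrr; exact: fspan0.
case: x y xy Aw => i j [s t]; rewrite /lex_le /qpair xpair_eqE -(val_eqE i) /= => xy Aw.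
case: (ltngtP (i : nat) s) xy => // is_ /=; last first.
  move=> jt; have {is_} is_ := val_inj is_; subst s.
  move: jt; rewrite leq_eqVlt => /orP[/eqP jt|jt].
    have {jt} jt := val_inj jt; subst t; rewrite eqxx /=.
    by apply: Z; rewrite scale1r.
  by rewrite -val_eqE [(j : nat) == t]ltn_eqF //=; apply: Z; apply: Zgen_row.
move=> _; rewrite -val_eqE.
case: (ltngtP j t) => jt /=.
- rewrite muln0 expr0 scale1r; have /= eq := Zgen_diag is_ jt.
  rewrite [Zword (_ ++ (i, j) :: _)]E [Zword (_ ++ (s, t) :: _)]E /= eq.
  rewrite mulrDr mulrDl [X in X - _]addrC addrK -scalerAr -scalerAl.
  apply: fspanZ => //.
    case: rL => _ SB _; apply: SB; [exact: laurentX | exact: laurentV].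
  rewrite -(E (i, t) (s, j)); apply: below_span; rewrite -Aw; exact: content_diag.
- by apply: Z; rewrite scale1r -Zgen_comm.
- by apply: Z; have {jt} jt := val_inj jt; subst t; apply: Zgen_col.
Qed.

Fixpoint qcount w : nat :=
  if w is x :: w' then (\sum_(y <- w') qpair x y + qcount w')%N else 0%N.

Lemma word_move u v x w : all (lex_le x) w -> content (u ++ x :: w ++ v) = A ->
  span A (Zword (u ++ x :: w ++ v) -
          q ^+ (2 * \sum_(y <- w) qpair x y) *: Zword (u ++ w ++ x :: v)).
Proof.
elim: w u => [|y w IH] u /=.
  by move=> _ _; rewrite big_nil expr0 scale1r subrr; apply: fspan0.
case/andP => xy xw Aw; rewrite big_cons mulnDr exprD.
apply: span_trans (word_swap xy Aw) _; first exact: laurentX.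
have := IH (rcons u y) xw; rewrite !cat_rcons; apply.
rewrite -Aw; apply: content_perm; rewrite perm_cat2l.
by apply/permP => P /=; rewrite addnCA.
Qed.

(** The first letter is moved to the end past letters not smaller than it; it then belongs to the
    right context while the tail is reversed. *)
Lemma word_rev u v w : pairwise lex_le w -> content (u ++ w ++ v) = A ->
  span A (Zword (u ++ w ++ v) - q ^+ (2 * qcount w) *: Zword (u ++ rev w ++ v)).
Proof.
elim: w u v => [|x w IH] u v /=.
  by move=> _ _; rewrite expr0 scale1r subrr; apply: fspan0.
case/andP => xw pw Aw; rewrite mulnDr exprD.
apply: span_trans (word_move xw Aw) _; first exact: laurentX.
rewrite rev_cons cat_rcons; apply: IH => //.
rewrite -Aw; apply: content_perm; rewrite perm_cat2l.
by apply/permP => P; rewrite /= !count_cat /= addnCA.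
Qed.

(** No order on the letters is assumed, so [word_swap] may be applied backwards; this brings
    negative powers of [q], and only the membership of [a] in Z[q, q^-1] is recorded. *)
Lemma word_perm u v w w' : perm_eq w w' -> content (u ++ w ++ v) = A ->
  exists2 a, laurent q a & span A (Zword (u ++ w ++ v) - a *: Zword (u ++ w' ++ v)).
Proof.
have swap u1 v1 x y : content (u1 ++ x :: y :: v1) = A -> exists2 a, laurent q a &
    span A (Zword (u1 ++ x :: y :: v1) - a *: Zword (u1 ++ y :: x :: v1)).
  move=> Aw; have Aw' : content (u1 ++ y :: x :: v1) = A.
    rewrite -Aw; apply: content_perm; rewrite perm_cat2l.
    by apply/permP => P /=; rewrite addnCA.
  have [xy|yx] := boolP (lex_le x y).
    by exists (q ^+ (2 * qpair x y)); [exact: laurentX | exact: word_swap].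
  have {}yx : lex_le y x by move: yx; rewrite /lex_le -!val_eqE /=; lia.
  have := word_swap yx Aw'; set a := (2 * _)%N => S1.
  exists (q ^- a); first exact: laurentV.
  by apply: span_sym S1; [exact: expf_neq0 | exact: laurentV].
have move1 u1 v1 x w1 : content (u1 ++ x :: w1 ++ v1) = A -> exists2 a,
    laurent q a & span A (Zword (u1 ++ x :: w1 ++ v1) -
                          a *: Zword (u1 ++ w1 ++ x :: v1)).
  elim: w1 u1 => [|y w1 IH] u1 /= Aw.
    exists 1; first by case: rL.
    by rewrite scale1r subrr; apply: fspan0.
  have [a La S1] := swap _ _ _ _ Aw.
  have [|b Lb] := IH (rcons u1 y).
    rewrite cat_rcons -Aw; apply: content_perm; rewrite perm_cat2l.
    by apply/permP => P /=; rewrite addnCA.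
  rewrite !cat_rcons => S2; exists (a * b); first by case: rL => _ _; apply.
  exact: span_trans S1 S2.
elim: w u v w' => [|x w IH] u v w' ww' Aw.
  move: ww'; rewrite perm_sym => /perm_nilP ->; exists 1; first by case: rL.
  by rewrite scale1r subrr; apply: fspan0.
have : x \in w' by rewrite -(perm_mem ww') mem_head.
move=> xw'; move: ww'; case/splitPr: xw' => w1 w2 ww'.
have {}ww' : perm_eq w (w1 ++ w2).
  by rewrite -(perm_cons x) (perm_trans ww') // -cat1s perm_catCA.
have [|a La] := IH (rcons u x) v _ ww'; rewrite !cat_rcons // => S1.
have [|b Lb S2] := move1 u (w2 ++ v) x w1.
  rewrite -Aw; apply: content_perm; rewrite perm_cat2l /= perm_cons catA.
  by rewrite perm_cat2r perm_sym.
exists (a * b); first by case: rL => _ _; apply.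
by apply: span_trans La _ _; [exact: S1 | rewrite -catA; rewrite -catA in S2 *].
Qed.

End Straighten.

Definition mx_word A : seq ('I_n * 'I_n) :=
  flatten [seq flatten [seq nseq (A i j) (i, j) | j <- index_enum 'I_n]
          | i <- index_enum 'I_n].

Lemma pairwise_flatten (T S : eqType) (r : rel T) (f : S -> seq T) (s : seq S) :
    (forall i, i \in s -> pairwise r (f i)) ->
    pairwise (fun i j => allrel r (f i) (f j)) s ->
  pairwise r (flatten [seq f i | i <- s]).
Proof.
elim: s => //= i s IH rf /andP[ris rs].
rewrite pairwise_cat rf ?mem_head //= IH // => [|j js]; last first.
  by apply: rf; rewrite inE js orbT.
rewrite andbT; apply/allrelP => a b ai /flattenP[t /mapP[j js ->] bj].
by have /allrelP := allP ris _ js; apply.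
Qed.

Lemma mx_word_pairwise A : pairwise lex_le (mx_word A).
Proof.
have sE : pairwise (fun i j : 'I_n => (i < j)%N) (index_enum 'I_n).
  rewrite [index_enum _]unlock -enumT.
  have := iota_ltn_sorted 0 n; rewrite -val_enum_ord sorted_map.
  by rewrite sorted_pairwise // => a b c; apply: ltn_trans.
apply: pairwise_flatten => [i _|].
  apply: pairwise_flatten => [j _|].
    elim: (A i j) => //= k ->; rewrite andbT; apply/allP => x.
    by move/nseqP => [-> _]; rewrite /lex_le eqxx leqnn orbT.
  apply: sub_pairwise sE => j k jk; apply/allrelP => a b.
  by move=> /nseqP[-> _] /nseqP[-> _]; rewrite /lex_le eqxx (ltnW jk) orbT.
apply: sub_pairwise sE => i k ik; apply/allrelP => a b.
move=> /flattenP[? /mapP[? _ ->] /nseqP[-> _]] /flattenP[? /mapP[? _ ->] /nseqP[-> _]].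
by rewrite /lex_le ik.
Qed.

Lemma big_mx_word (R : Type) (idx : R) (op : Monoid.law idx) A (F : _ -> R) :
  \big[op/idx]_(x <- mx_word A) F x =
  \big[op/idx]_i \big[op/idx]_j iter (A i j) (op (F (i, j))) idx.
Proof.
rewrite /mx_word big_flatten big_map; apply: eq_bigr => i _.
rewrite big_flatten big_map; apply: eq_bigr => j _.
exact: big_nseq.
Qed.

Lemma Zword_mx_word A : Zword (mx_word A) = Zmon q A.
Proof.
rewrite /Zword big_mx_word; apply: eq_bigr => i _; apply: eq_bigr => j _.
exact: iter_mulr_1.
Qed.

Lemma sum_mx_word A (F : 'I_n * 'I_n -> nat) :
  (\sum_(x <- mx_word A) F x = \sum_i \sum_j A i j * F (i, j))%N.
Proof.
rewrite big_mx_word; apply: eq_bigr => i _; apply: eq_bigr => j _.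
by rewrite iter_addn_0 mulnC.
Qed.

Lemma content_mx_word A : content (mx_word A) = A.
Proof.
apply/matrixP => i j; rewrite mxE -sum1_count big_mkcond sum_mx_word /=.
rewrite (bigD1 i) //= (bigD1 j) //= eqxx muln1 !big1 ?addn0 // => [i' ii|j' jj].
  by apply: big1 => j' _; rewrite xpair_eqE (negPf ii) muln0.
by rewrite xpair_eqE (negPf jj) andbF muln0.
Qed.

(* Symmetrizing both counts avoids comparing two enumerations of the pairs i < j. *)
Lemma double_qcount w : (2 * qcount w = \sum_(x <- w) \sum_(y <- w) qpair x y)%N.
Proof.
have qC x y : qpair x y = qpair y x.
  by rewrite /qpair eq_sym [x.1 == _]eq_sym [x.2 == _]eq_sym.
have q0 x : qpair x x = false by rewrite /qpair eqxx.
elim: w => [|x w IH]; first by rewrite big_nil.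
rewrite /= mulnDr IH !big_cons q0 add0n.
have -> : (\sum_(i <- w) \sum_(y <- x :: w) qpair i y =
    \sum_(i <- w) qpair x i + \sum_(i <- w) \sum_(y <- w) qpair i y)%N.
  by rewrite -big_split; apply: eq_bigr => i _; rewrite big_cons qC.
by rewrite addnA mul2n -addnn.
Qed.

Lemma double_pairs (f : 'I_n -> nat) :
  (\sum_(j < n) \sum_(k < n | k != j) f j * f k =
   2 * \sum_(j < n) \sum_(k < n | k < j) f j * f k)%N.
Proof.
rewrite mul2n -addnn.
have -> : (\sum_(j < n) \sum_(k < n | k != j) f j * f k =
    \sum_(j < n) \sum_(k < n | k < j) f j * f k + \sum_(j < n) \sum_(k < n | j < k) f j * f k)%N.
  rewrite -big_split; apply: eq_bigr => j _ /=.
  rewrite (bigID (fun k : 'I_n => k < j)%N) /=; congr (_ + _)%N; apply: eq_bigl => k;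
    rewrite -val_eqE /=; lia.
congr (_ + _)%N; rewrite (exchange_big_dep xpredT) //=.
by apply: eq_bigr => j _; apply: eq_bigr => k _; rewrite mulnC.
Qed.

(** Doubled, both sides sum products of entries over ordered pairs of distinct positions in a common
    row or column; the row pairs and the column pairs are the two sums of [Dexp]. *)
Lemma qcount_mx_word A : qcount (mx_word A) = Dexp A.
Proof.
apply/eqP; rewrite -(eqn_pmul2l (ltn0Sn 1)) double_qcount; apply/eqP.
rewrite /Dexp mulnDr !big_distrr /=.
under [X in (X + _)%N]eq_bigr => i _ do rewrite -(double_pairs (fun j => A i j)).
under [X in (_ + X)%N]eq_bigr => i _ do rewrite -(double_pairs (fun j => A j i)).
rewrite [X in (_ + X)%N]exchange_big -big_split sum_mx_word; apply: eq_bigr => i _ /=.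
rewrite -big_split; apply: eq_bigr => j _ /=; rewrite sum_mx_word -!big_distrr -mulnDr.
congr (_ * _)%N; rewrite (bigD1 i) //=; congr (_ + _)%N.
  rewrite [RHS]big_mkcond; apply: eq_bigr => l _.
  by rewrite /qpair xpair_eqE /= eqxx /= andbT eq_sym; case: eqP; rewrite ?muln0 ?muln1.
apply: eq_bigr => k ki; rewrite (bigD1 j) //= big1 => [|l lj].
  by rewrite /qpair xpair_eqE /= eqxx orbT andbT andbT eq_sym ki muln1 addn0.
rewrite /qpair /= [i == k]eq_sym [j == l]eq_sym (negPf ki) (negPf lj).
by rewrite andbF muln0.
Qed.

Lemma content_inj u v : content u = content v -> perm_eq u v.
Proof.
move=> uv; apply/allP => -[i j] _ /=; apply/eqP.
by move/matrixP/(_ i j): uv; rewrite !mxE.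
Qed.

Lemma Zmon_norm A : Zmon q A = q ^+ Dexp A *: Znorm q A.
Proof. by rewrite /Znorm scalerA mulfV ?scale1r // expf_neq0. Qed.

(** This discharges [below_span], by induction on the content [B]: modulo lower terms [w] is a
    multiple of [mx_word B], which represents [q ^+ Dexp B *: Znorm q B]. *)
Lemma span_word A w : content w \in fbelow A -> span A (Zword w).
Proof.
have PA : forall B w, content w = B ->
    fspan (Znorm q) (laurent q) (B |` fbelow B)%fset (Zword w).
  apply: fbelow_ind => B IH {}w wB.
  have bB w' : content w' \in fbelow B -> span B (Zword w').
    move=> w'B; apply: fspan_sub (IH _ w'B w' erefl) => // C.
    by rewrite in_fset1U => /orP[/eqP -> //|CB]; apply: fbelow_trans w'B.
  have ww : perm_eq w (mx_word B) by apply: content_inj; rewrite content_mx_word.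
  have [|a La] := @word_perm B bB [::] [::] _ _ ww; first by rewrite cats0.
  rewrite !cats0 /= => S1; rewrite -[Zword w](subrK (a *: Zword (mx_word B))).
  apply: fspanD => //; first by apply: fspan_sub S1 => // C CB; rewrite in_fset1U CB orbT.
  rewrite Zword_mx_word Zmon_norm; do 2 apply: fspanZ => //; first exact: laurentX.
  by apply: fspan_mem => //; rewrite in_fset1U eqxx.
move=> wA; apply: fspan_sub (PA _ w erefl) => // C.
by rewrite in_fset1U => /orP[/eqP -> //|CB]; apply: fbelow_trans wA.
Qed.

(** * The bar involution on normalized monomials *)

Section Bar.
Variable sigma : {rmorphism K -> K}.
Hypothesis sigma_q : sigma q = q^-1.

Lemma bar_Zword w : bar sigma (Zword w) = Zword (rev w).
Proof.
elim: w => [|x w IH]; first by rewrite /Zword /rev !big_nil bar1.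
rewrite Zword_cons (barM q_neq0 sigma_q) IH (bar_gen q_neq0 sigma_q) rev_cons -cats1 Zword_cat.
by congr (_ * _); rewrite /Zword big_seq1.
Qed.

Lemma bar_Znorm A : bar sigma (Znorm q A) = q ^+ Dexp A *: Zword (rev (mx_word A)).
Proof.
have E : sigma (q ^- Dexp A) = q ^+ Dexp A.
  by rewrite fmorphV rmorphXn /= sigma_q exprVn invrK.
rewrite /Znorm (barZ q_neq0 sigma_q) E; congr (_ *: _).
by rewrite -Zword_mx_word bar_Zword.
Qed.

Lemma bar_barZnorm A : bar sigma (bar sigma (Znorm q A)) = Znorm q A.
Proof.
have E : sigma (q ^+ Dexp A) = q ^- Dexp A by rewrite rmorphXn /= sigma_q exprVn.
rewrite bar_Znorm (barZ q_neq0 sigma_q) E; congr (_ *: _).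
by rewrite bar_Zword revK Zword_mx_word.
Qed.

Lemma bar_Znorm_span A : span A (bar sigma (Znorm q A) - Znorm q A).
Proof.
have := @word_rev A (@span_word A) [::] [::] _ (mx_word_pairwise A).
rewrite /= !cats0 content_mx_word qcount_mx_word => /(_ erefl).
(* Multiplication by [- q ^- Dexp A] normalizes [Zmon q A] and leaves the reversed word with
   [q ^+ Dexp A], its coefficient in [bar_Znorm]. *)
move/(fspanZ rL (laurentV q (Dexp A)))/(fspanN rL).
rewrite bar_Znorm /Znorm Zword_mx_word scalerBr opprB scalerA.
suff -> : q ^- Dexp A * q ^+ (2 * Dexp A) = q ^+ Dexp A by [].
by rewrite mul2n -addnn exprD mulrA mulVf ?expf_neq0 // mul1r.
Qed.

End Bar.

End Words.

(** * Bar-antisymmetric Laurent polynomials *)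

Section Scalars.

Lemma Zq_val_tofrac (f : {poly int}) :
  Zq_val q f = @FracField.tofrac {poly rat} (map_poly intr f).
Proof.
elim/poly_ind: f => [|f c IH]; first by rewrite !rmorph0.
rewrite !rmorphD !rmorphM /= IH Zq_valX map_polyX; congr (_ * _ + _).
by rewrite /Zq_val !map_polyC hornerC /= !rmorph_int.
Qed.

Lemma Zq_val_inj : injective (Zq_val q).
Proof.
move=> f g; rewrite !Zq_val_tofrac => /eqP; rewrite tofrac_eq => /eqP.
by apply: map_inj_poly => //; apply: intr_inj.
Qed.

Lemma barQq_Zq_val f : barQq (Zq_val q f) = Zq_val q^-1 f.
Proof.
rewrite /Zq_val -horner_map /= barQq_q -map_poly_comp; congr (_.[_]).
by apply: eq_map_poly => c /=; rewrite rmorph_int.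
Qed.

(* Multiplying by q^(deg f) turns f(1/q) into the reversed polynomial, whose
   constant term is the leading coefficient of f. *)
Lemma Zq_val_inv_eq f g : Zq_val q^-1 f = Zq_val q g -> (size f <= 1)%N.
Proof.
move=> fg; rewrite leqNgt; apply/negP => fs.
case sf: (size f) fs => [|[|m]] // _.
pose r : {poly int} := \poly_(i < m.+2) f`_(m.+1 - i).
have rE : r = 'X^(m.+1) * g.
  apply: Zq_val_inj; rewrite rmorphM rmorphXn /= Zq_valX -fg /Zq_val.
  have sz (f' : {poly int}) : (size f' <= m.+2)%N ->
      (size (map_poly intr f' : {poly Qq}) <= m.+2)%N.
    exact/leq_trans/size_poly.
  rewrite !(@horner_coef_wide _ m.+2) ?sz ?sf ?size_poly //.
  rewrite big_distrr (reindex_inj rev_ord_inj) /=; apply: eq_bigr => i _.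
  have im : (i <= m.+1)%N by rewrite -ltnS.
  rewrite !coef_map coef_poly subSS ltnS leq_subr subKn //= mulrCA; congr (_ * _).
  by rewrite exprVn -expfB_cond ?(negPf q_neq0).
have := congr1 (fun p : {poly int} => p`_0) rE.
rewrite coef_poly /= subn0 coefXnM /= => /eqP.
by rewrite -[m.+1]/(m.+2.-1) -sf -lead_coefE lead_coef_eq0 -size_poly_eq0 sf.
Qed.

Lemma poly_X_size (f : {poly int}) : (size ('X * f)%R <= 1)%N -> f = 0.
Proof.
by have [-> //|f0] := eqVneq f 0; rewrite mulrC size_mulX // ltnS leqn0 size_poly_eq0 (negPf f0).
Qed.

Lemma bar_fix_pos f : barQq (Zq_val q ('X * f)) = Zq_val q ('X * f) -> f = 0.
Proof. by rewrite barQq_Zq_val => /Zq_val_inv_eq/poly_X_size. Qed.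

Lemma poly_splitX (f : {poly int}) : exists g c, f = 'X * g + c%:P.
Proof.
by elim/poly_ind: f => [|f c _]; [exists 0, 0; rewrite mulr0 addr0 | exists f, c; rewrite mulrC].
Qed.

Lemma laurent_split a : laurent q a -> exists h h' c,
  a = Zq_val q ('X * h) + Zq_val q^-1 ('X * h') + c%:~R.
Proof.
have ZC (x : Qq) c : Zq_val x c%:P = c%:~R by rewrite /Zq_val map_polyC hornerC.
case=> k [f ->] {a}; elim: k => [|k [h [h' [c IH]]]].
  have [g [c ->]] := poly_splitX f; exists g, 0, c.
  by rewrite expr0 invr1 mul1r mulr0 rmorph0 addr0 rmorphD /= ZC.
(* Division by [q] sends the old constant [c] to the negative part and makes the constant term of
   [h] the new constant. *)
have [g [d hE]] := poly_splitX h; exists g, ('X * h' + c%:P), d.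
rewrite exprS invfM -mulrA IH !mulrDr !rmorphD /= !rmorphM /= !Zq_valX.
rewrite mulKf ?q_neq0 // hE rmorphD rmorphM /= Zq_valX !ZC.
rewrite -!addrA; congr (_ + _).
by rewrite addrC -!addrA; congr (_ + _).
Qed.

(** Split [a] into a positive part from [h], a negative part from [h'] and a constant [c].
    Antisymmetry equates a polynomial in [q^-1] with one in [q]; both are then constant, so
    [h' = - h] and [c + c = 0]. *)
Lemma laurent_skew a : laurent q a -> barQq a = - a ->
  exists h, a = Zq_val q ('X * h) - barQq (Zq_val q ('X * h)).
Proof.
have barV f : barQq (Zq_val q^-1 f) = Zq_val q f.
  rewrite /Zq_val -horner_map /= fmorphV /= barQq_q invrK -map_poly_comp.
  by congr (_.[_]); apply: eq_map_poly => c /=; rewrite rmorph_int.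
have ZC c : Zq_val q c%:P = c%:~R by rewrite /Zq_val map_polyC hornerC.
case/laurent_split => h [h' [c aE]]; rewrite {1}aE !rmorphD /= barQq_Zq_val barV.
rewrite rmorph_int => ba.
have E : Zq_val q^-1 ('X * (h + h')) = Zq_val q (- ('X * (h + h')) - (c + c)%:P).
  rewrite !mulrDr rmorphB rmorphN !rmorphD /= !ZC.
  move/eqP: ba; rewrite aE -subr_eq0 => /eqP ba; apply/eqP; rewrite -subr_eq0 -ba.
  apply/eqP; ring.
have /poly_X_size hh := Zq_val_inv_eq E.
move: E; rewrite hh mulr0 rmorph0 oppr0 add0r -(rmorph0 (Zq_val q)).
move/Zq_val_inj/eqP; rewrite eq_sym oppr_eq0 polyC_eq0 => cc; exists h.
have c0 : c = 0 by move/eqP: cc; lia.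
rewrite aE c0 addr0 barQq_Zq_val; congr (_ + _).
by rewrite -rmorphN -mulrN; congr (Zq_val _ (_ * _)); apply/eqP; rewrite -addr_eq0 addrC hh.
Qed.

End Scalars.

(** * The Kazhdan-Lusztig argument *)

Section Triangular.
Variables (K : fieldType) (V : lmodType K) (M : choiceType).
Variables (lower : M -> {fset M}) (rank : M -> nat).
Hypothesis rankP : forall A B, B \in lower A -> (rank B < rank A)%N.
Implicit Types (v w : M -> V) (c : {malg K[M]}) (A B C : M).

Definition free_family v := forall c, malg_lift v c = 0 -> c = 0.

Lemma free_family_scale v (u : M -> K) : (forall A, u A != 0) ->
  free_family v -> free_family (fun A => u A *: v A).
Proof.
move=> u0 fv c c0; pose c' := malg_lift (fun A => << u A *g A >>) c.
have c'0 : c' = 0.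
  apply: fv; rewrite -c0 /c' [X in malg_lift v X]/malg_lift linear_sum; apply: eq_bigr => A _.
  by rewrite linearZ /= malg_liftU.
apply/malgP => A; have := congr1 (mcoeff A) c'0; rewrite !mcoeff0 => /eqP cA.
apply: contraTeq cA => cA.
rewrite /c' /malg_lift raddf_sum /= (big_fsetD1 A) /=; last by rewrite -mcoeff_neq0.
rewrite mcoeffZ mcoeffUU big_seq big1 => [|B /fsetD1P[BA _]].
  by rewrite addr0 mulf_neq0 // mcoeff_neq0.
by rewrite mcoeffZ mcoeffU (negPf BA) mulr0.
Qed.

Definition unitriangular v w A := exists r : M -> K,
  w A = v A + \sum_(B <- lower A) r B *: v B.

(* An index of maximal rank among those with c A <> 0 receives no contribution
   from the other w B, so there c A = c' A.  With c' = 0 this is independence of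
   w; with w = bar v and c = bar c' it is uniqueness of the canonical elements. *)
Lemma unitriangular_coef v w (F : {fset M}) (c c' : M -> K) : free_family v ->
    (forall A, A \in F -> unitriangular v w A) ->
    \sum_(A <- F) c A *: w A = \sum_(A <- F) c' A *: v A ->
    (forall A, A \in F -> c A = c' A -> c A = 0) ->
  forall A, A \in F -> c A = 0.
Proof.
move=> fv uw E cc'.
have /choice[r rE] : forall A, exists r : M -> K, A \in F ->
    w A = v A + \sum_(B <- lower A) r B *: v B.
  move=> A; have [AF|_] := boolP (A \in F); last by exists (fun=> 0).
  by have [r rA] := uw A AF; exists r.
pose b A : {malg K[M]} := << A >> + \sum_(B <- lower A) << r A B *g B >>.
have bE A : A \in F -> malg_lift v (b A) = w A.
  move=> AF; rewrite rE // linearD linear_sum /= malg_liftU scale1r; congr (_ + _).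
  by apply: eq_bigr => B _; rewrite malg_liftU.
have e0 : \sum_(A <- F) c A *: b A = \sum_(A <- F) c' A *: << A >>.
  apply/eqP; rewrite -subr_eq0; apply/eqP/fv; rewrite linearB /=.
  have -> : malg_lift v (\sum_(A <- F) c A *: b A) = \sum_(A <- F) c A *: w A.
    by rewrite linear_sum; apply: eq_big_seq => A AF; rewrite /= linearZ /= bE.
  have -> : malg_lift v (\sum_(A <- F) c' A *: << A >>) = \sum_(A <- F) c' A *: v A.
    by rewrite linear_sum; apply: eq_bigr => A _; rewrite /= linearZ /= malg_liftU scale1r.
  by rewrite E subrr.
pose N := \max_(A <- F) rank A.
(* Descending induction on the rank: the coefficients at indices of larger rank are already known to
   vanish. *)
move=> A; have [k] := ubnP (N - rank A); elim: k A => // k IH A /ltnSE Ak AF.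
apply: cc' => //; have := congr1 (mcoeff A) e0; rewrite !raddf_sum /=.
rewrite [LHS](big_fsetD1 A) // [RHS](big_fsetD1 A) //=.
rewrite !mcoeffZ mcoeffD mcoeffUU raddf_sum /= [X in 1 + X]big_seq big1; last first.
  move=> B BA; rewrite mcoeffU; case: eqP => // BA'; rewrite BA' in BA.
  by have := rankP BA; rewrite ltnn.
rewrite addr0 !mulr1 [X in _ + X]big_seq big1 ?[X in _ = _ + X]big_seq ?[X in _ = _ + X]big1.
- by rewrite !addr0.
- by move=> B /fsetD1P[BA _]; rewrite mcoeffZ mcoeffU (negPf BA) mulr0.
move=> B /fsetD1P[BA BF]; rewrite mcoeffZ mcoeffD mcoeffU (negPf BA) add0r raddf_sum /=.
have [AB|AB] := boolP (A \in lower B); last first.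
  rewrite big_seq big1 ?mulr0 // => C CB; rewrite mcoeffU; case: eqP => // CA.
  by rewrite CA (negPf AB) in CB.
rewrite IH ?mul0r //; have BN : (rank B <= N)%N by apply: leq_bigmax_seq.
by have := rankP AB; lia.
Qed.

Lemma unitriangular_free v w (F : {fset M}) (c : M -> K) : free_family v ->
    (forall A, A \in F -> unitriangular v w A) -> \sum_(A <- F) c A *: w A = 0 ->
  forall A, A \in F -> c A = 0.
Proof.
move=> fv uw E; apply: (unitriangular_coef (c' := fun=> 0) fv uw) => //.
by rewrite E big1 // => A _; rewrite scale0r.
Qed.

Lemma unitriangular_inv S v w (F : {fset M}) : subring_prop S ->
    (forall A, A \in F -> fspan v S (lower A) (w A - v A)) ->
    (forall A B, A \in F -> B \in lower A -> B \in F) ->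
  forall A, A \in F -> fspan w S F (v A).
Proof.
move=> rS wv dF; apply: (lower_ind rankP) => A IH AF.
rewrite -[v A](subKr (w A)); apply: fspanB => //; first exact: fspan_mem.
have [c [Sc ->]] := wv A AF; apply: fspan_sum => // B BA.
by apply: fspanZ => //; apply: IH => //; apply: dF BA.
Qed.

Lemma fspan_unitriangular S v w A : fspan v S (lower A) (w A - v A) -> unitriangular v w A.
Proof. by case=> c [_ E]; exists c; rewrite -E addrC subrK. Qed.

End Triangular.

Section Canonical.
Variables (M : choiceType) (V : lmodType Qq) (v : M -> V) (lower : M -> {fset M}).
Variable br : V -> V.

(** The factor [q] in front of a Z[q]-combination encodes coefficients in qZ[q]; [canonicalP]
    recovers them one by one. *)
Definition canonical A (b : V) := br b = b /\ exists2 y,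
  b = v A + q *: y & fspan v (Zq_prop q) (lower A) y.

Lemma canonicalP A (b : V) : canonical A b <->
  br b = b /\ exists h : M -> {poly int},
    (forall B, exists g : {poly int}, h B = 'X * g) /\
    b = v A + \sum_(B <- lower A) Zq_val q (h B) *: v B.
Proof.
have XE (g : M -> {poly int}) : q *: (\sum_(B <- lower A) Zq_val q (g B) *: v B) =
    \sum_(B <- lower A) Zq_val q ('X * g B) *: v B.
  rewrite scaler_sumr; apply: eq_bigr => B _.
  by rewrite scalerA rmorphM /= Zq_valX.
split=> [[bb [y bE [c [/choice[g cg] yE]]]]|[bb [h [/choice[g hg] bE]]]]; split=> //.
  exists (fun B => 'X * g B); split=> [B|]; first by exists (g B).
  by rewrite bE yE -XE; congr (_ + _ *: _); apply: eq_bigr => B _; rewrite cg.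
exists (\sum_(B <- lower A) Zq_val q (g B) *: v B); last first.
  by exists (fun B => Zq_val q (g B)); split=> // B; exists (g B).
by rewrite bE XE; congr (_ + _); apply: eq_bigr => B _; rewrite hg.
Qed.

Lemma canonical_Zspan A b : canonical A b -> fspan v (Zq_prop q) (lower A) (b - v A).
Proof.
case=> _ [y -> Sy]; rewrite addrC addKr; apply: fspanZ; [exact: subring_Zq | | exact: Sy].
by exists 'X; rewrite Zq_valX.
Qed.

End Canonical.

Section CanonicalFamily.
Variables (M : choiceType) (V : lmodType Qq) (v : M -> V) (br : {additive V -> V}).
Variables (lower : M -> {fset M}) (rank : M -> nat).
Implicit Types A B : M.
Hypotheses (rankP : forall A B, B \in lower A -> (rank B < rank A)%N)
  (lower_trans : forall A B C, C \in lower B -> B \in lower A -> C \in lower A).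
Hypotheses (brZ : forall a x, br (a *: x) = barQq a *: br x)
  (v_free : free_family v) (br_brv : forall A, br (br (v A)) = v A)
  (br_v : forall A, fspan v (laurent q) (lower A) (br (v A) - v A)).

Let rL := subring_laurent q_neq0.
Let rZ := subring_Zq q.
Local Notation canonical := (canonical v lower br).

Lemma canonical_ex A : exists b, canonical A b.
Proof.
move: A; apply: (lower_ind rankP) => A IH.
have /choice[b bP] : forall B, exists b, B \in lower A -> canonical B b.
  (* Choice asks for a total family; outside [lower A] the value 0 is a placeholder. *)
  move=> B; have [BA|_] := boolP (B \in lower A); last by exists 0.
  by have [b bB] := IH B BA; exists b.
have bv B : B \in lower A -> fspan v (Zq_prop q) (lower B) (b B - v B).
  by move=> BA; apply/canonical_Zspan/bP.
have FL F x : fspan v (Zq_prop q) F x -> fspan v (laurent q) F x.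
  by case=> c [Zc ->]; exists c; split=> // B; apply: Zq_laurent.
have vb B : B \in lower A -> fspan b (laurent q) (lower A) (v B).
  move: B; apply: (unitriangular_inv rankP rL) => [C CA|C D CA DC]; first exact/FL/bv.
  exact: lower_trans CA.
have [s [Ls sE]] : fspan b (laurent q) (lower A) (br (v A) - v A).
  by have [c [Lc ->]] := br_v A; apply: fspan_sum => // B BA; apply/fspanZ/vb.
have brb : br (\sum_(B <- lower A) s B *: b B) =
    \sum_(B <- lower A) barQq (s B) *: b B.
  rewrite raddf_sum /=; apply: eq_big_seq => B BA.
  by rewrite brZ; have [-> _] := bP B BA.
(* As [br] is an involution on [v A], it negates [br (v A) - v A]. The [b B] are fixed by [br] and
   independent, so the sign passes to the coefficients. *)
have s_skew B : B \in lower A -> barQq (s B) = - s B.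
  move=> BA; apply/eqP; rewrite -addr_eq0; apply/eqP.
  apply: (unitriangular_free (c := fun B => barQq (s B) + s B) rankP v_free _ _ BA) => [C CA|].
    exact/fspan_unitriangular/bv.
  under eq_bigr => C _ do rewrite scalerDl.
  by rewrite big_split /= -brb -sE raddfB /= br_brv addrC subrKA subrr.
have /choice[h hE] : forall B, exists h, B \in lower A ->
    s B = Zq_val q ('X * h) - barQq (Zq_val q ('X * h)).
  move=> B; have [BA|_] := boolP (B \in lower A); last by exists 0.
  by have [h hB] := laurent_skew (Ls B) (s_skew B BA); exists h.
(* Under [br] the first summand gains [s B] at [b B], and the coefficient ['X * h B] becomes its
   bar; the two changes cancel by the choice of [h]. *)
exists (v A + q *: \sum_(B <- lower A) Zq_val q (h B) *: b B); split; last first.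
  eexists; first by [].
  apply: fspan_sum => // B BA; apply: fspanZ => //; first by exists (h B).
  rewrite -[b B](subrK (v B)); apply: fspanD => //; last exact: fspan_mem.
  by apply: fspan_sub (bv B BA) => // C CB; apply: lower_trans BA.
have E : q *: (\sum_(B <- lower A) Zq_val q (h B) *: b B) =
    \sum_(B <- lower A) Zq_val q ('X * h B) *: b B.
  rewrite scaler_sumr; apply: eq_bigr => B _.
  by rewrite scalerA rmorphM /= Zq_valX.
rewrite E raddfD /= -[br (v A)](subrK (v A)) sE addrAC addrC; congr (_ + _).
rewrite raddf_sum -big_split; apply: eq_big_seq => B BA /=.
by rewrite brZ; have [-> _] := bP B BA; rewrite hE // -scalerDl subrK.
Qed.

Lemma canonical_uniq A b b' : canonical A b -> canonical A b' -> b = b'.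
Proof.
case=> brb [y bE [c [Zc yE]]] [brb' [y' bE' [c' [Zc' yE']]]].
have /choice[f fE] B : exists f, c B - c' B = Zq_val q f.
  by case: (Zc B) => g ->; case: (Zc' B) => g' ->; exists (g - g'); rewrite rmorphB.
pose e B := Zq_val q ('X * f B).
have d : b - b' = \sum_(B <- lower A) e B *: v B.
  rewrite bE bE' opprD addrACA subrr add0r -scalerBr yE yE' -sumrB scaler_sumr.
  apply: eq_bigr => B _; rewrite -scalerBl fE scalerA; congr (_ *: _).
  by rewrite /e rmorphM /= Zq_valX.
(* Zero is the only bar-invariant element of qZ[q]. This is the condition under which
   [unitriangular_coef] compares the two expansions of the bar-invariant [b - b']. *)
have f0 B : barQq (e B) = e B -> barQq (e B) = 0.
  by move/bar_fix_pos; rewrite /e => ->; rewrite mulr0 !rmorph0.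
apply/eqP; rewrite -subr_eq0 d big_seq big1 // => B BA.
suff /eqP : barQq (e B) = 0 by rewrite fmorph_eq0 => /eqP ->; rewrite scale0r.
apply: (unitriangular_coef (w := fun B => br (v B)) (c := fun B => barQq (e B)) (c' := e)
  rankP v_free _ _ _ BA) => [C _||C _ ]; [exact: fspan_unitriangular | | exact: f0].
rewrite -d; transitivity (br (b - b')); last by rewrite raddfB /= brb brb'.
by rewrite d raddf_sum; apply: eq_bigr => C _; rewrite /= brZ.
Qed.

End CanonicalFamily.

(** * The basis of the lattice and its uniqueness *)

Section ZqComb.
Variables (K : fieldType) (q : K) (n : nat) (v : 'M[nat]_n -> Oq q n).

Lemma Zq_combEw (c : {malg {poly int}['M[nat]_n]}) (d : {fset 'M[nat]_n}) :
  fsubset (msupp c) d ->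
  Zq_comb v c = \sum_(A <- d) Zq_val q (mcoeff A c) *: v A.
Proof.
move=> le; rewrite /Zq_comb (big_fset_incl _ le) //= => A _ /mcoeff_outdom ->.
by rewrite rmorph0 scale0r.
Qed.

Lemma Zq_comb_fspan x : (exists c, x = Zq_comb v c) <->
  exists F, fspan v (Zq_prop q) F x.
Proof.
split=> [[c ->]|[F [c [Zc ->]]]].
  exists (msupp c), (fun A => Zq_val q (mcoeff A c)); split=> // A.
  by exists (mcoeff A c).
have /choice[f fE] := Zc.
exists (\sum_(A <- F) << f A *g A >>).
rewrite (@Zq_combEw _ F); last first.
  apply/fsubsetP => A; rewrite -mcoeff_neq0 mcoeff_sumU.
  by case: ifP => //; rewrite eqxx.
by apply: eq_big_seq => A AF; rewrite fE mcoeff_sumU AF.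
Qed.

End ZqComb.

Lemma Znorm_free (K : fieldType) (q : K) (n : nat) : q != 0 ->
  free_family (@Znorm K q n).
Proof.
move=> q0; apply: free_family_scale; last exact: Zmon_free.
by move=> A; rewrite invr_eq0 expf_neq0.
Qed.

Section OqCanonical.
Variable n : nat.
Local Notation v := (@Znorm _ q n).
Local Notation Zspan := (fspan v (Zq_prop q)).
Local Notation can := (canonical v (@fbelow n) (@bar _ q n barQq)).

Let rZ := subring_Zq q.

(** The change of family is unitriangular over Z[q], and it is inverted over Z[q] inside the finite
    downward closed sets formed by [A] and [fbelow A]. *)
Lemma canonical_basis (b : 'M[nat]_n -> Oq q n) :
  (forall A, can A (b A)) -> is_Zq_basis (Lstar q n) b.
Proof.
move=> bP; have bv A : Zspan (fbelow A) (b A - v A) by apply: canonical_Zspan (bP A).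
split=> [A|x [c ->] {x}].
  apply/Zq_comb_fspan; exists (A |` fbelow A)%fset.
  rewrite -[b A](subrK (v A)); apply: fspanD => //; last first.
    by apply: fspan_mem => //; rewrite in_fset1U eqxx.
  by apply: fspan_sub (bv A) => // B BA; rewrite in_fset1U BA orbT.
have [c' c'E] : exists c', Zq_comb v c = Zq_comb b c'.
  apply/Zq_comb_fspan; rewrite /Zq_comb.
  elim: (msupp c : seq _) => [|A s [F sF]].
    by exists fset0; rewrite big_nil; apply: fspan0.
  exists (F `|` (A |` fbelow A))%fset; rewrite big_cons; apply: fspanD => //; last first.
    by apply: fspan_sub sF => // B BF; rewrite in_fsetU BF.
  apply: fspanZ => //; first by exists (mcoeff A c).
  apply: (@fspan_sub _ _ _ _ _ rZ (A |` fbelow A)%fset) => [B BA|].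
    by rewrite in_fsetU BA orbT.
  apply: (unitriangular_inv (@card_fbelow n) rZ) => [B _|B C|]; [exact: bv | | ].
    rewrite !in_fset1U => /orP[/eqP ->|BA] CB; first by rewrite CB orbT.
    by rewrite (fbelow_trans CB BA) orbT.
  by rewrite in_fset1U eqxx.
exists c'; split=> [|c'' c''E]; first exact: c'E.
apply/malgP => A.
pose d := (msupp c' `|` msupp c'')%fset.
have [Ad|Ad] := boolP (A \in d); last first.
  by move: Ad; rewrite in_fsetU negb_or => /andP[/mcoeff_outdom -> /mcoeff_outdom ->].
apply: Zq_val_inj; apply/eqP; rewrite -subr_eq0; apply/eqP; move: A Ad.
apply: (unitriangular_free (@card_fbelow n) (@Znorm_free _ _ n q_neq0) (w := b)) => [A _|].
  exact: fspan_unitriangular (bv A).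
under eq_bigr => A _ do rewrite scalerBl.
have E' := Zq_combEw b (fsubsetUl (msupp c') (msupp c'')).
have E'' := Zq_combEw b (fsubsetUr (msupp c') (msupp c'')).
rewrite sumrB; apply/eqP; rewrite subr_eq0; apply/eqP.
transitivity (Zq_comb b c'); first exact (esym E').
transitivity (Zq_comb b c''); last exact E''.
by transitivity (Zq_comb v c); [exact (esym c'E) | exact c''E].
Qed.

End OqCanonical.

Theorem theorem3p2 (n : nat) :
  exists! b : 'M[nat]_n -> Oq q n,
    [/\ is_Zq_basis (Lstar q n) b,
        (forall A, bar barQq (b A) = b A) &
        (forall A, exists h : 'M[nat]_n -> {poly int},
           (forall B, exists g : {poly int}, h B = 'X * g) /\
           b A = Znorm q A
                 + \sum_(B \in below A) Zq_val q (h B) *: Znorm q B)].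
Proof.
pose br : {additive Oq q n -> Oq q n} := HB.pack_for {additive Oq q n -> Oq q n}
  (@bar _ q n barQq)
  (GRing.isZmodMorphism.Build _ _ _ (bar_is_zmod_morphism (n := n) q_neq0 barQq_q)).
have brZ a x : br (a *: x) = barQq a *: br x by apply: barZ q_neq0 barQq_q _ _.
have vf := @Znorm_free _ _ n q_neq0.
have brv (A : 'M[nat]_n) : br (br (Znorm q A)) = Znorm q A.
  exact (bar_barZnorm q_neq0 barQq_q A).
have brs (A : 'M[nat]_n) :
    fspan (Znorm q) (laurent q) (fbelow A) (br (Znorm q A) - Znorm q A).
  exact (bar_Znorm_span q_neq0 barQq_q A).
have /choice[b bP] := canonical_ex (@card_fbelow n)
  (fun A B => @fbelow_trans n B A) brZ vf brv brs.
(* The sum over the classical set [below A] agrees with the one over [fbelow A] by finiteness. *)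
have hP (A : 'M[nat]_n) x : canonical (Znorm q) (@fbelow n) br A x <->
    br x = x /\ exists h : 'M[nat]_n -> {poly int},
      (forall B, exists g : {poly int}, h B = 'X * g) /\
      x = Znorm q A + \sum_(B \in below A) Zq_val q (h B) *: Znorm q B.
  split=> [/canonicalP|] [bx [h [hX hE]]].
    split; [exact: bx | exists h; split; [exact: hX | rewrite hE]].
    by congr (_ + _); rewrite fsbig_finite //; apply: finite_below.
  apply/canonicalP; split; [exact: bx | exists h; split; [exact: hX | rewrite hE]].
  by congr (_ + _); rewrite fsbig_finite //; apply: finite_below.
exists b; split=> [|b' [_ bb' hb']].
  split=> [|A|A]; first exact: canonical_basis.
    by have /hP[] := bP A.
  by have /hP[] := bP A.
apply/funext => A.
apply: (canonical_uniq (@card_fbelow n) brZ vf brs (bP A)).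
by apply/hP; split; [exact: bb' | exact: hb'].
Qed.
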